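(* For every real quadratic number $\alpha$, the positive number $\psi=\psi(\alpha)$ defined in the context satisfies $[0,\psi]\subset Sp_{\alpha}$. (In particular, for every real quadratic number $\alpha$ there exists a positive number $\psi$ such that $[0,\psi]\subset Sp_\alpha$.)
   Context: A real quadratic number is an irrational real number that is algebraic of degree $2$ over $\mathbb{Q}$; $x^{\sigma}$ denotes the Galois conjugate of a quadratic number $x$. For a real quadratic number $\alpha$, let $\Theta_{\alpha}=PSL(2,\mathbb{Z})\{\alpha,\alpha^{\sigma}\}$ be the union of the orbits of $\alpha$ and $\alpha^\sigma$ under the action of $PSL(2,\mathbb{Z})$ by fractional linear transformations. For a real number $\xi\notin\mathbb{Q}\cup\Theta_\alpha$ put $$c_{\alpha}\xi:=\liminf_{\beta\in\Theta_{\alpha},\ |\beta-\beta^{\sigma}|\rightarrow 0}\ 2\,\frac{|\xi-\beta|}{|\beta-\beta^{\sigma}|}.$$ The quadratic Lagrange spectrum of $\alpha$ is $Sp_{\alpha}:=\{c_{\alpha}\xi : \xi\in\mathbb{R}\setminus(\mathbb{Q}\cup\Theta_\alpha)\}$. Definition of $\psi(\alpha)$: the (regular) continued fraction expansion of $\alpha$ is eventually periodic; let $b_1,\dots,b_s$ be its shortest period (of length $s$; it is determined up to cyclic permutation, which does not affect what follows). Let $B=2+\max(b_1,\dots,b_s)$, and let $n$ be the minimal positive integer satisfying $2^{(n-1)s}>16\cdot16\cdot36\cdot144\,B^{2s+8}$. Then $$\psi(\alpha)=\frac{1}{72\cdot72\,B^{s(6n+6)+4}}.$$ *)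

(* Defs.v *)
From HB Require Import structures.
From mathcomp Require Import all_boot all_order all_algebra.
From mathcomp Require Import all_classical all_reals all_analysis.
Set Implicit Arguments.
Unset Strict Implicit.
Unset Printing Implicit Defensive.
Import Order.TTheory GRing.Theory Num.Theory.
Import numFieldNormedType.Exports.
Local Open Scope classical_set_scope.
Local Open Scope ring_scope.

Definition is_minpoly (R : realType) (x : R) (p : {poly rat}) : Prop :=
  [/\ p \is monic, root (map_poly ratr p) x
    & forall q : {poly rat}, root (map_poly ratr q) x -> p %| q].

(* [size p = 3] means that the minimal polynomial has degree 2. *)
Definition real_quadratic (R : realType) (x : R) : Prop :=
  irrational x /\ exists2 p : {poly rat}, is_minpoly x p & size p = 3%N.

(* For a quadratic x, this is the other root of its minimal polynomial, which
   exists and is unique; the default value x is only taken for the other reals. *)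
Definition galois_conj (R : realType) (x : R) : R :=
  xget x [set y | y != x /\
    exists2 p : {poly rat}, is_minpoly x p & root (map_poly ratr p) y].

Definition mobius (R : realType) (g : 'M[int]_2) (x : R) : R :=
  ((g 0 0)%:~R * x + (g 0 1)%:~R) / ((g 1 0)%:~R * x + (g 1 1)%:~R).

(* The classes of matrices in PSL(2,Z) are represented by elements of SL(2,Z);
   g and - g act in the same way. *)
Definition PSL2Z_orbit (R : realType) (x : R) : set R :=
  [set y | exists2 g : 'M[int]_2, \det g = 1 & y = mobius g x].

Definition Theta (R : realType) (alpha : R) : set R :=
  PSL2Z_orbit alpha `|` PSL2Z_orbit (galois_conj alpha).

(* The filter "beta in Theta_alpha, |beta - beta^sigma| -> 0". *)
Definition Theta_filter (R : realType) (alpha : R) : set_system R :=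
  filter_from [set e : R | 0 < e]
    (fun e => [set beta | Theta alpha beta /\
                          `|beta - galois_conj beta| < e]).

Definition approx_const (R : realType) (alpha xi : R) : \bar R :=
  limf_einf
    (fun beta : R => (2 * (`|xi - beta| / `|beta - galois_conj beta|))%:E)
    (Theta_filter alpha).

Definition quadratic_spectrum (R : realType) (alpha : R) : set (\bar R) :=
  approx_const alpha @` (~` (@rational R `|` Theta alpha)).

Definition complete_quotient (R : realType) (x : R) (k : nat) : R :=
  iter k (fun y : R => (y - (Num.floor y)%:~R)^-1) x.

Definition partial_quotient (R : realType) (x : R) (k : nat) : int :=
  Num.floor (complete_quotient x k).

Definition cf_period (R : realType) (x : R) (b : seq nat) : Prop :=
  (0 < size b)%N /\
  exists N : nat, forall k : nat,
    partial_quotient x (N + k)%N = (nth 0%N b (k %% size b)%N)%:Z.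

Definition cf_shortest_period (R : realType) (x : R) (b : seq nat) : Prop :=
  cf_period x b /\
  forall b' : seq nat, cf_period x b' -> (size b <= size b')%N.

(* A shortest period is only determined up to cyclic permutation; [psi] depends
   on it only through its length and its largest element. *)
Definition period (R : realType) (x : R) : seq nat :=
  xget [::] [set b | cf_shortest_period x b].

Definition psi_B (b : seq nat) : nat := (2 + \max_(i <- b) i)%N.

Definition psi_n_cond (b : seq nat) (n : nat) : Prop :=
  (0 < n)%N /\
  (16 * 16 * 36 * 144 * psi_B b ^ (2 * size b + 8)
     < 2 ^ ((n - 1) * size b))%N.

Definition psi_n (b : seq nat) : nat :=
  xget 0%N [set n | psi_n_cond b n /\
                    forall m : nat, psi_n_cond b m -> (n <= m)%N].

Definition psi (R : realType) (alpha : R) : R :=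
  let b := period alpha in
  1 / (72 * 72 * (psi_B b)%:R ^+ (size b * (6 * psi_n b + 6) + 4)%N).

(* Main.v *)
Require Import Defs.
From HB Require Import structures.
From mathcomp Require Import all_boot all_order all_algebra.
From mathcomp Require Import all_classical all_reals all_analysis.
From mathcomp Require Import ring lra zify.
Import Order.TTheory GRing.Theory Num.Theory.
Import numFieldNormedType.Exports.
Local Open Scope classical_set_scope.
Local Open Scope ring_scope.

(** For b in Theta = Theta_alpha let b' be its conjugate, D(b) = |b - b'|, and
k(x; b) = 2 |x - b| / D(b), so that the constant of xi is the lower limit of
k(xi; b) as D(b) tends to 0.  Given a small c >= 0, the proof builds xi with
k(xi; b) >= c for every b in Theta, and with k(xi; b_n) -> c along a sequence
with D(b_n) -> 0.  Such a xi has constant exactly c.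

The members of Theta are roots of integral binary forms of one discriminant
Delta.  This has three consequences, collected in [quadratic_family].
- Theta and conjugation are compatible with SL2(Z).  Hence the cross ratio
  R(x, y; b) = 2 |y - b| |x - b'| / (|x - y| D(b)) is invariant when x, y and b
  are moved together, and k(y; b) is its value at x = infinity.
- Members are separated: min(D(b1), D(b2)) <= 6 Delta |b1 - b2| for b1 != b2,
  because the invariant 2 a1 a2 (b1 - b2)(b1' - b2') of two forms of
  discriminant Delta is a nonzero integer ([disc_form_sep]).
- A rational p/q stays away from b at the scale 1/q^2 ([disc_form_rat]).

A rational point m whose least constant min_b k(m; b) lies in [t, t + e), for
prescribed small t and e, is obtained as follows ([prescribed_min]).  Look for
u near alpha and v near alpha' with R(v, u; alpha) = t, while all other members
have a larger cross ratio.  The equation makes v a homographic function of u,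
and the other members cause no harm as soon as u and v both stay out of a ball
of radius proportional to t D(b) around each b with D(b) < D(alpha); the larger
ones are too far from alpha and alpha' to matter.  By separation, an interval
for u meets at most one such ball at each scale, and so does its image; so
nested intervals produce u ([avoid_two], [real_pair]).  This replaces the
arithmetic of two Cantor sets: a single sequence of intervals takes care of
u and v together.  Convergents then replace u and v by rational numbers at the
cost of a constant factor ([rational_avoid]), and an element of SL2(Z) that
sends the rational v to infinity sends the rational u to m.

Such points are glued at a cusp ([cusp_step]).  Let P = h(infinity) be rational
with k(P; b) >= l for all b, and put P' = h(m + N) with N large.  In the
coordinate h^-1 the pair (infinity, P') becomes (h^-1(infinity), m + N), two
points at a distance much larger than every D(b).  The cross ratio of such a
pair is, up to a factor close to 1, bounded below by the smaller of the
constants k(P; b) and k(m; h^-1 b - N) ([cusp_excursion]); and the member that is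
nearly optimal for m yields one with small D that is nearly optimal for P'.
Iterating with bounds decreasing to c gives xi as a limit
([spectrum_of_steps]).

The construction reaches every c <= 1 / (2 10^6 Delta^2).  Any form that kills
alpha may be used here.  The period b_1, ..., b_s, which exists by Lagrange's
theorem ([cf_period_exists]), writes a complete quotient as a fixed point of a
matrix with entries at most B^s, hence gives a form with Delta <= 5 B^(2s)
([disc_form_of_period]); psi(alpha) is far below the resulting bound. *)

(** * Completeness of the real line *)

Lemma nested_balls (R : realType) (p r : nat -> R) :
  (forall k, `|p k.+1 - p k| <= r k - r k.+1) -> (forall k, 0 <= r k) ->
  exists x, forall k, `|x - p k| <= r k.
Proof.
move=> hp hr.
have lo k : p k - r k <= p k.+1 - r k.+1.
  by move: (hp k); rewrite ler_norml => /andP[]; lra.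
have hi k : p k.+1 + r k.+1 <= p k + r k.
  by move: (hp k); rewrite ler_norml => /andP[]; lra.
have lo_mono j k : p j - r j <= p (j + k)%N - r (j + k)%N.
  by elim: k => [|k IH]; rewrite ?addn0// addnS (le_trans IH).
have hi_mono j k : p (j + k)%N + r (j + k)%N <= p j + r j.
  by elim: k => [|k IH]; rewrite ?addn0// addnS (le_trans _ IH).
have lohi j k : p j - r j <= p k + r k.
  have h1 := lo_mono j k; have h2 := hi_mono k j; rewrite addnC in h2.
  by have := hr (j + k)%N; lra.
pose A := range (fun k => p k - r k).
have supA : has_sup A.
  by split; [exists (p 0%N - r 0%N), 0%N|exists (p 0%N + r 0%N) => _ [k _ <-]].
exists (sup A) => k; rewrite ler_norml; apply/andP; split.
  have : p k - r k <= sup A by apply: sup_upper_bound => //; exists k.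
  lra.
have : sup A <= p k + r k by apply: ge_sup (supA.1) _ => _ [j _ <-] ;exact: lohi.
lra.
Qed.

Lemma small_geometric (R : realType) (a e : R) : 0 < e -> exists k, a / 16 ^+ k < e.
Proof.
move=> e0.
have [n hn] : exists n : nat, a / e < n%:R.
  exists (Num.bound `|a / e|); apply: le_lt_trans (ler_norm _) _.
  exact: archi_boundP.
exists n; rewrite ltr_pdivrMr ?exprn_gt0//.
rewrite ltr_pdivrMr// mulrC in hn; apply: lt_le_trans hn _.
rewrite ler_wpM2l ?ltW//.
have -> : 16 ^+ n = (16 ^ n)%:R :> R by rewrite natrX.
by rewrite ltr_nat ltn_expl.
Qed.

Lemma dep_choice (T : choiceType) (P : nat -> T -> Prop) (Q : nat -> T -> T -> Prop) x0 :
  P 0%N x0 ->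
  (forall k x, P k x -> exists y, P k.+1 y /\ Q k x y) ->
  exists f : nat -> T, [/\ f 0%N = x0, forall k, P k (f k) & forall k, Q k (f k) (f k.+1)].
Proof.
move=> h0 hS.
pose g k x := xget x [set y | P k.+1 y /\ Q k x y].
pose f := fix f k := if k is j.+1 then g j (f j) else x0.
have gP k x : P k x -> P k.+1 (g k x) /\ Q k x (g k x).
  by move=> /hS[y hy]; rewrite /g; case: xgetP => [z -> //|/(_ y)[]].
have Pf k : P k (f k) by elim: k => [//|k /gP[]].
by exists f; split => // k; have [] := gP k _ (Pf k).
Qed.

(** * Points that avoid two families of balls *)

(** Choosing between the left and the right quarter of an interval. All obstacles
have size [D b] in one window, so separation allows at most one centre near the
image of the interval, and its ball is too small to reach the images of both
quarters. *)
Lemma avoid_quarter (R : realType) (S : set R) (D phi : R -> R)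
    (kap c m M lo hi p r : R) :
  0 < r -> 0 <= c -> 0 <= kap ->
  (forall b b', S b -> S b' -> b != b' ->
    kap * Num.min (D b) (D b') <= `|b - b'|) ->
  (forall x x', `|x - p| <= r -> `|x' - p| <= r ->
    m * `|x - x'| <= `|phi x - phi x'| <= M * `|x - x'|) ->
  0 <= m -> 0 <= M ->
  2 * M * r + 2 * c * hi <= kap * lo -> 2 * c * hi <= m * r ->
  exists p', `|p' - p| <= 3 / 4 * r /\
    forall x, `|x - p'| <= r / 4 -> forall b, S b -> lo < D b -> D b <= hi ->
      c * D b <= `|phi x - b|.
Proof.
move=> r0 c0 k0 sep lip m0 M0 h1 h2.
pose bad q := exists x b, [/\ `|x - q| <= r / 4, S b, lo < D b, D b <= hi &
  `|phi x - b| < c * D b].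
have good q : ~ bad q -> forall x, `|x - q| <= r / 4 -> forall b, S b ->
    lo < D b -> D b <= hi -> c * D b <= `|phi x - b|.
  move=> nb x hx b Sb l1 l2; rewrite leNgt; apply/negP => h.
  by apply: nb; exists x, b.
have [|nbl] := pselect (bad (p - 3 / 4 * r)); last first.
  exists (p - 3 / 4 * r); split; last exact: good.
  by rewrite addrC addKr normrN ger0_norm//; lra.
move=> [x [b [hx Sb l1 l2 hb]]].
exists (p + 3 / 4 * r); split; first by rewrite addrC addKr ger0_norm//; lra.
apply: good => -[x' [b' [hx' Sb' l1' l2' hb']]].
move: hx hx'; rewrite !ler_norml => /andP[hx1 hx2] /andP[hx'1 hx'2].
have ax : `|x - p| <= r by rewrite ler_norml; lra.
have ax' : `|x' - p| <= r by rewrite ler_norml; lra.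
have /andP[lip1 lip2] := lip x x' ax ax'.
have cb : c * D b <= c * hi by rewrite ler_wpM2l.
have cb' : c * D b' <= c * hi by rewrite ler_wpM2l.
have dx : `|x - x'| = x' - x by rewrite distrC ger0_norm//; lra.
have tri : `|b - b'| <= `|phi x - b| + `|phi x - phi x'| + `|phi x' - b'|.
  have := ler_distD (phi x) b b'; have := ler_distD (phi x') (phi x) b'.
  by rewrite [`|b - phi x|]distrC; lra.
have [bb|nbb] := eqVneq b b'.
  rewrite -bb in hb' cb'.
  have := ler_distD b (phi x) (phi x'); rewrite [`|b - phi x'|]distrC.
  have : m * r <= m * `|x - x'| by rewrite ler_wpM2l// dx; lra.
  lra.
have := sep b b' Sb Sb' nbb.
have : kap * lo <= kap * Num.min (D b) (D b').
  by rewrite ler_wpM2l// le_min !ltW.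
have : M * `|x - x'| <= M * (2 * r) by rewrite ler_wpM2l// dx; lra.
lra.
Qed.

(** [avoid_quarter] is applied alternately to [phi1] and [phi2]; each round divides
the radius by 16 and treats the obstacles of one window, and the windows of
successive rounds are adjacent. The obstacles above the first window are the
object of the last hypothesis. A single point thus solves a condition on
[phi1 x] and one on [phi2 x], for instance on a number and a function of it. *)
Lemma avoid_two (R : realType) (S : set R) (D phi1 phi2 : R -> R)
    (kap c m M p0 r0 : R) :
  0 < r0 -> 0 <= c -> 0 < kap -> 0 < m -> m <= M ->
  512 * M * c <= kap * m ->
  (forall b, S b -> 0 < D b) ->
  (forall b b', S b -> S b' -> b != b' ->
    kap * Num.min (D b) (D b') <= `|b - b'|) ->
  (forall phi, phi = phi1 \/ phi = phi2 -> forall x x', `|x - p0| <= r0 -> `|x' - p0| <= r0 ->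
    m * `|x - x'| <= `|phi x - phi x'| <= M * `|x - x'|) ->
  (forall phi, phi = phi1 \/ phi = phi2 -> forall x b, `|x - p0| <= r0 -> S b ->
     64 * M * r0 < kap * D b ->
     c * D b <= `|phi x - b|) ->
  exists2 x, `|x - p0| <= r0 &
    forall b, S b -> c * D b <= `|phi1 x - b| /\ c * D b <= `|phi2 x - b|.
Proof.
move=> r00 c0 k0 m0 mM hc D0 sep lip ini.
(* With this K, the balls of size at most K r have radius small compared with the
   image of the interval, and those of size above K r / 16 have centres further
   apart than the length of that image. *)
pose K := 64 * M / kap.
have KE : kap * K = 64 * M by rewrite /K; field; rewrite gt_eqF.
have M0 : 0 < M by apply: lt_le_trans mM.
have K0 : 0 < K by rewrite /K divr_gt0// mulr_gt0.
have cK : 8 * (c * K) <= m.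
  rewrite -(ler_pM2l k0) (_ : kap * (8 * (c * K)) = 8 * c * (kap * K)); last by ring.
  by rewrite KE; lra.
pose r k := r0 / 16 ^+ k.
have rS k : r k.+1 = r k / 16.
  by rewrite /r exprS; field; rewrite expf_neq0// pnatr_eq0.
have rgt k : 0 < r k by rewrite /r divr_gt0// exprn_gt0.
have rle k : r k <= r0.
  rewrite /r ler_pdivrMr ?exprn_gt0// ler_peMr; [by []|exact: ltW|].
  by apply: exprn_ege1; lra.
pose ok (phi : R -> R) k (p : R) := forall x b, `|x - p| <= r k -> S b -> K * r k < D b ->
   c * D b <= `|phi x - b|.
pose P k p := [/\ `|p - p0| <= r0 - r k, ok phi1 k p & ok phi2 k p].
pose Q k (p p' : R) := `|p' - p| <= r k - r k.+1.
have P0 : P 0%N p0.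
  rewrite /P /ok /r expr0 divr1 !subrr normr0; split=> // x b hx Sb hb;
   apply: ini => //; try (by [left|right]); by rewrite -KE -mulrA ltr_pM2l.
have [|f [_ fP fQ]] := @dep_choice _ P Q p0 P0.
  move=> k p [pp0 ok1 ok2].
  have inI x : `|x - p| <= r k -> `|x - p0| <= r0.
    by move=> h; have := ler_distD p x p0; lra.
  have rk := rgt k.
  have crk : 8 * (c * (K * r k)) <= m * r k by have := ler_wpM2r (ltW rk) cK; lra.
  have mr0 : 0 < m * r k by rewrite mulr_gt0.
  have krk : kap * (K * r k / 16) = 4 * M * r k.
    by transitivity (kap * K * r k / 16); [ring|rewrite KE; field].
  have mMr : m * r k <= M * r k by rewrite ler_wpM2r// ltW.
  have [|||p1 [p1p h1]] := @avoid_quarter R S D phi1 kap c m M (K * r k / 16)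
    (K * r k) p (r k) rk c0 (ltW k0) sep _ (ltW m0) (ltW M0).
  - by move=> x x' /inI hx /inI hx'; apply: lip => //; left.
  - by rewrite krk; lra.
  - by lra.
  have rk4 : 0 < r k / 4 by rewrite divr_gt0.
  have [|||p2 [p2p h2]] := @avoid_quarter R S D phi2 kap c m M (K * r k / 16)
    (K * r k) p1 (r k / 4) rk4 c0 (ltW k0) sep _ (ltW m0) (ltW M0).
  - move=> x x' hx hx'; apply: lip; rewrite ?inI//; first by right.
      by have := ler_distD p1 x p; lra.
    by have := ler_distD p1 x' p; lra.
  - by rewrite krk; lra.
  - by lra.
  exists p2; split; last by rewrite /Q rS; have := ler_distD p1 p2 p; lra.
  have p2p' := ler_distD p1 p2 p.
  split; first by rewrite rS; have := ler_distD p p2 p0; lra.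
    move=> x b; rewrite rS => hx Sb hb.
    have xp1 := ler_distD p2 x p1.
    have [hb'|hb'] := leP (D b) (K * r k).
      apply: h1 => //; first by lra.
      by rewrite -mulrA.
    by apply: ok1 => //; have := ler_distD p1 x p; lra.
  move=> x b; rewrite rS => hx Sb hb.
  have xp1 := ler_distD p2 x p1.
  have [hb'|hb'] := leP (D b) (K * r k).
    by apply: h2 => //; [lra|rewrite -mulrA].
  by apply: ok2 => //; have := ler_distD p1 x p; lra.
have [|x hx] := @nested_balls R f r fQ; first by move=> k; exact: ltW.
exists x; first by have := hx 0%N; have [] := fP 0%N; have := ler_distD (f 0%N) x p0; lra.
move=> b Sb; have [k hk] := small_geometric _ (K * r0) _ (D0 b Sb).
have [_ o1 o2] := fP k.
by split; [apply: o1|apply: o2]; rewrite ?hx// /r mulrA.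
Qed.

(** * Continued fractions and rational approximation *)

Lemma complete_quotientS (R : realType) (x : R) k :
  complete_quotient x k.+1 = (complete_quotient x k - (partial_quotient x k)%:~R)^-1.
Proof. by []. Qed.

Lemma complete_quotientD (R : realType) (x : R) j k :
  complete_quotient x (j + k) = complete_quotient (complete_quotient x j) k.
Proof. by rewrite /complete_quotient addnC iterD. Qed.

Lemma partial_quotientD (R : realType) (x : R) j k :
  partial_quotient x (j + k) = partial_quotient (complete_quotient x j) k.
Proof. by rewrite /partial_quotient complete_quotientD. Qed.

Lemma irrational_complete_quotient (R : realType) (x : R) k :
  irrational x -> irrational (complete_quotient x k).
Proof.
move=> xirr; elim: k => [//|k IH]; rewrite complete_quotientS => -[q _ qE].
apply: IH; exists (q^-1 + (partial_quotient x k)%:~R) => //.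
rewrite rmorphD/= ratr_int; apply/esym/eqP; rewrite -subr_eq; apply/eqP.
by rewrite -[LHS]invrK -qE fmorphV.
Qed.

Lemma complete_quotient_eq (R : realType) (x : R) k : irrational x ->
  0 < complete_quotient x k.+1 /\
  complete_quotient x k = (partial_quotient x k)%:~R + (complete_quotient x k.+1)^-1.
Proof.
move=> xirr; split; last by rewrite complete_quotientS invrK addrC subrK.
rewrite complete_quotientS invr_gt0 subr_gt0 lt_neqAle; apply/andP; split; last exact: floor_le.
apply/eqP => h; apply: (irrational_complete_quotient R x k xirr).
by rewrite -h; exists (partial_quotient x k)%:~R => //; rewrite ratr_int.
Qed.

Lemma complete_quotient_gt1 (R : realType) (x : R) k : irrational x ->
  1 < complete_quotient x k.+1.
Proof.
move=> xirr; have [h0 E] := complete_quotient_eq R x k xirr.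
rewrite -(invrK (complete_quotient x k.+1)) invf_gt1; last by rewrite invr_gt0.
have := floorD1_gt (complete_quotient x k); rewrite -/(partial_quotient x k).
by rewrite {1}E intrD; lra.
Qed.

Lemma partial_quotient_ge1 (R : realType) (x : R) k : irrational x ->
  1 <= partial_quotient x k.+1.
Proof.
by move=> xirr; rewrite /partial_quotient floor_ge_int; apply: ltW; apply: complete_quotient_gt1.
Qed.

(** The two last convergents p'/q' and p/q come with the identity
x = (p y + p') / (q y + q') for all numbers [x'] that share the first k + 1
digits of [x]: this makes them comparable in [digits_inj]. The last clause
bounds the entries of the product of the matrices of the digits. *)
Lemma convergents (R : realType) (x : R) k : irrational x ->
  exists p q p' q' : int,
  [/\ [/\ (p * q' - p' * q) ^+ 2 = 1, 0 <= q', q' <= q, 1 <= q & (k.+1)%:Z <= q + q'],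
   (forall x' : R, irrational x' ->
      (forall j, (j <= k)%N -> partial_quotient x' j = partial_quotient x j) ->
      let y := complete_quotient x' k.+1 in
      x' * (q%:~R * y + q'%:~R) = p%:~R * y + p'%:~R) &
   forall B : int,
     (forall j, (j <= k)%N -> 1 <= partial_quotient x j /\ partial_quotient x j + 1 <= B) ->
     [/\ 0 <= p, 0 <= p', p + p' <= B ^+ k.+1 & q + q' <= B ^+ k.+1]].
Proof.
move=> xirr; elim: k => [|k [p [q [p' [q' [[dt q'0 q'q q1 kq] hx hB]]]]]].
  exists (partial_quotient x 0), 1, 1, 0; split.
  - by split => //; ring.
  - move=> x' x'irr /(_ 0%N isT) E y.
    have [h0] := complete_quotient_eq R x' 0 x'irr; rewrite E => h.
    have {}h : x' = (partial_quotient x 0)%:~R + (complete_quotient x' 1)^-1 := h.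
    rewrite -/y in h0 h; clearbody y; rewrite h mulr1z mulr0z.
    by field; rewrite gt_eqF.
  - move=> B /(_ 0%N isT); move: (partial_quotient x 0) => a [h1 h2].
    by rewrite !expr1; split; lia.
have a1 := partial_quotient_ge1 R x k xirr.
set a := partial_quotient x k.+1 in a1.
exists (p * a + p'), (q * a + q'), p, q; split.
- split.
  + by rewrite -dt; ring.
  + by lia.
  + by nia.
  + by nia.
  + by nia.
- move=> x' x'irr hj y.
  have [h0 h] := complete_quotient_eq R x' k.+1 x'irr.
  have E := hx x' x'irr (fun j hh => hj j (leqW hh)); cbv zeta in E.
  rewrite h hj// -/a -/y in E; rewrite -/y in h0; clearbody y.
  have y0 : y != 0 by rewrite gt_eqF.
  rewrite !intrD !intrM.
  have := congr1 (fun z => z * y) E; rewrite /=.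
  rewrite (_ : x' * _ * y = x' * (q%:~R * (a%:~R * y + 1) + q'%:~R * y)); last by field.
  rewrite (_ : (p%:~R * _ + _) * y = p%:~R * (a%:~R * y + 1) + p'%:~R * y); last by field.
  by lra.
- move=> B hj; have [p0 p'0 pB qB] := hB B (fun j hh => hj j (leqW hh)).
  have [_ aB] := hj k.+1 (leqnn _); rewrite -/a in aB.
  have hp : (p + p') * (a + 1) <= B ^+ k.+1 * B by apply: ler_pM => //; lia.
  have hq : (q + q') * (a + 1) <= B ^+ k.+1 * B by apply: ler_pM => //; lia.
  by rewrite exprSr; split; nia.
Qed.

(** Both errors times q y + q' are explicit, since the determinant is 1 or -1. *)
Lemma convergent_errors (R : realType) (x y : R) (p q p' q' : int) :
  (p * q' - p' * q) ^+ 2 = 1 -> 0 <= q' -> 1 <= q -> 1 < y ->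
  x * (q%:~R * y + q'%:~R) = p%:~R * y + p'%:~R ->
  `|q%:~R * x - p%:~R| * q%:~R <= 1 /\ `|q'%:~R * x - p'%:~R| * q%:~R <= 1.
Proof.
move=> dt q'0 q1 y1 E.
have q'R : 0 <= q'%:~R :> R by rewrite ler0z.
have qR : 1 <= q%:~R :> R by rewrite -[1]/(1%:~R) ler_int.
have dtR : `|p%:~R * q'%:~R - p'%:~R * q%:~R| = 1 :> R.
  apply/eqP; rewrite -(@eqrXn2 _ 2)// real_normK ?num_real// expr1n.
  by rewrite -!intrM -rmorphB/= -rmorphXn/= dt.
set d : R := q%:~R * y + q'%:~R in E *.
have qy : q%:~R * 1 <= q%:~R * y by apply: ler_wpM2l; lra.
have dq : q%:~R <= d by rewrite /d; lra.
have d0 : 0 < d by lra.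
have E1 : `|q%:~R * x - p%:~R| * d = 1.
  rewrite -[RHS]dtR -[d in LHS]gtr0_norm// -normrM distrC; congr `|_|.
  by rewrite mulrBl -mulrA E /d; ring.
have E2 : `|q'%:~R * x - p'%:~R| * d = y.
  have y0 : 0 < y by lra.
  transitivity (`|p%:~R * q'%:~R - p'%:~R * q%:~R| * `|y|); last first.
    by rewrite dtR mul1r gtr0_norm.
  rewrite -[d in LHS]gtr0_norm// -!normrM; congr `|_|.
  by rewrite mulrBl -mulrA E /d; ring.
split.
  by apply: le_trans (ler_wpM2l (normr_ge0 _) dq) _; rewrite E1.
have h : `|q'%:~R * x - p'%:~R| * (q%:~R * y) <= 1 * y.
  by rewrite mul1r -{2}E2; apply: ler_wpM2l => //; rewrite /d; lra.
by rewrite mulrA ler_pM2r in h => //; lra.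
Qed.

(** Convergents for an irrational [x]; a rational [x] is its own approximation. *)
Lemma rational_approx (R : realType) (x eta : R) : 0 < eta ->
  exists p q : int, [/\ q != 0, `|p%:~R / q%:~R - x| < eta &
    `|p%:~R / q%:~R - x| * q%:~R ^+ 2 <= 1].
Proof.
move=> eta0; have [xrat|xirr] := pselect (rational x).
  case: xrat => r _ <-; exists (numq r), (denq r); rewrite denq_neq0.
  have -> : (numq r)%:~R / (denq r)%:~R - ratr r = 0 :> R.
    by rewrite -{3}(divq_num_den r) fmorph_div/= !ratr_int subrr.
  by rewrite normr0 mul0r.
have [k hk] : exists k : nat, 2 / eta < k%:R.
  by exists (Num.bound (2 / eta)); apply: archi_boundP; rewrite divr_ge0// ltW.
have [p [q [p' [q' [[dt q'0 q'q q1 kq] hx _]]]]] := convergents R x k xirr.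
have [e1 _] := convergent_errors R x _ _ _ _ _ dt q'0 q1 (complete_quotient_gt1 R x k xirr)
   (hx x xirr (fun j _ => erefl)).
exists p, q; have q0 : q != 0 by lia.
have qR : 0 < q%:~R :> R by rewrite ltr0z; lia.
have E : `|p%:~R / q%:~R - x| * q%:~R = `|q%:~R * x - p%:~R|.
  rewrite -[q%:~R in LHS]gtr0_norm// -normrM distrC; congr `|_|.
  by rewrite gtr0_norm//; field; rewrite gt_eqF.
split => //; last by rewrite expr2 mulrA E.
have kR : k%:R <= 2 * q%:~R :> R.
  by rewrite -[2]/(2%:~R) -intrM -[k%:R]/(k%:~R) ler_int; lia.
have q1R : 1 <= q%:~R :> R by rewrite -[1]/(1%:~R) ler_int.
rewrite -(ltr_pM2r qR) E; apply: (@le_lt_trans _ _ 1).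
  apply: le_trans e1; rewrite -[leLHS]mulr1; exact: ler_wpM2l.
rewrite ltr_pdivrMr// in hk.
have : eta * k%:R <= eta * (2 * q%:~R) by apply: ler_wpM2l => //; exact: ltW.
by lra.
Qed.

(** Numbers with the same digits have the same convergents. *)
Lemma digits_inj (R : realType) (x x' : R) : irrational x -> irrational x' ->
  (forall k, partial_quotient x' k = partial_quotient x k) -> x' = x.
Proof.
move=> xirr x'irr hd; apply/eqP; rewrite -subr_eq0 -normr_eq0; apply/eqP.
apply/eqP; rewrite eq_le normr_ge0 andbT; apply/ler_addgt0Pr => e e0; rewrite add0r.
have [k hk] : exists k : nat, 4 / e < k%:R.
  by exists (Num.bound (4 / e)); apply: archi_boundP; rewrite divr_ge0// ltW.
have [p [q [p' [q' [[dt q'0 q'q q1 kq] hx _]]]]] := convergents R x k xirr.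
have [e1 _] := convergent_errors R x _ _ _ _ _ dt q'0 q1 (complete_quotient_gt1 R x k xirr)
   (hx x xirr (fun j _ => erefl)).
have [e2 _] := convergent_errors R x' _ _ _ _ _ dt q'0 q1 (complete_quotient_gt1 R x' k x'irr)
   (hx x' x'irr (fun j _ => hd j)).
have q1R : 1 <= q%:~R :> R by rewrite -[1]/(1%:~R) ler_int.
have qR : 0 < q%:~R :> R by lra.
have kR : k%:R <= 2 * q%:~R :> R.
  by rewrite -[2]/(2%:~R) -intrM -[k%:R]/(k%:~R) ler_int; lia.
rewrite ltr_pdivrMr// in hk.
have h : e * k%:R <= e * (2 * q%:~R) by apply: ler_wpM2l => //; exact: ltW.
have s1 : `|q%:~R * x - p%:~R| <= 1.
  by apply: le_trans e1; rewrite -[leLHS]mulr1; exact: ler_wpM2l.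
have s2 : `|q%:~R * x' - p%:~R| <= 1.
  by apply: le_trans e2; rewrite -[leLHS]mulr1; exact: ler_wpM2l.
rewrite -(ler_pM2r qR) -[q%:~R in leLHS]gtr0_norm// -normrM.
rewrite (_ : _ * _ = (q%:~R * x' - p%:~R) - (q%:~R * x - p%:~R)); last by ring.
by apply: le_trans (ler_normB _ _) _; lra.
Qed.

(** * Fractional linear transformations *)

(** The transformation of [mobius] with the matrix given by its four entries. *)
Definition mob (R : realType) (a b c d : int) (x : R) : R :=
  (a%:~R * x + b%:~R) / (c%:~R * x + d%:~R).

Arguments mob {R}.

Lemma irrational_affine (R : realType) (x : R) (c d : int) :
  irrational x -> c != 0 -> c%:~R * x + d%:~R != 0.
Proof.
move=> xirr c0; apply/eqP => h; apply: xirr.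
exists ((- d)%:~R / c%:~R) => //; rewrite fmorph_div/= !ratr_int.
have c0' : c%:~R != 0 :> R by rewrite intr_eq0.
rewrite rmorphN/=; have -> : d%:~R = - (c%:~R * x) by lra.
by field.
Qed.

Lemma irrational_den (R : realType) (x : R) (a b c d : int) :
  irrational x -> a * d - b * c = 1 -> c%:~R * x + d%:~R != 0.
Proof.
move=> xirr h; have [c0|] := eqVneq c 0; last exact: irrational_affine.
rewrite c0 mul0r add0r intr_eq0; apply/eqP => d0.
by move: h; rewrite c0 d0 !mulr0 subrr => /eqP; rewrite eq_sym oner_eq0.
Qed.

Lemma det_real (R : realType) (a b c d : int) : a * d - b * c = 1 ->
  a%:~R * d%:~R - b%:~R * c%:~R = 1 :> R.
Proof. by move=> h; rewrite -!rmorphM -rmorphB h. Qed.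

Lemma mob_sub (R : realType) (a b c d : int) (x y : R) : a * d - b * c = 1 ->
  c%:~R * x + d%:~R != 0 -> c%:~R * y + d%:~R != 0 ->
  mob a b c d x - mob a b c d y =
    (x - y) / ((c%:~R * x + d%:~R) * (c%:~R * y + d%:~R)).
Proof.
move=> h hx hy; have hd := @det_real R _ _ _ _ h; rewrite /mob.
transitivity ((a%:~R * d%:~R - b%:~R * c%:~R) *
  ((x - y) / ((c%:~R * x + d%:~R) * (c%:~R * y + d%:~R)))).
  by field; exact/andP.
by rewrite hd mul1r.
Qed.

(** The point a/c is the image of infinity, so this is [mob_sub] in the limit. *)
Lemma mob_cusp_sub (R : realType) (a b c d : int) (y : R) : a * d - b * c = 1 ->
  c != 0 -> c%:~R * y + d%:~R != 0 ->
  a%:~R / c%:~R - mob a b c d y = (c%:~R * (c%:~R * y + d%:~R))^-1.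
Proof.
move=> h c0 hy; have hd := @det_real R _ _ _ _ h; rewrite /mob.
have c0' : c%:~R != 0 :> R by rewrite intr_eq0.
transitivity ((a%:~R * d%:~R - b%:~R * c%:~R) / (c%:~R * (c%:~R * y + d%:~R))).
  by field; exact/andP.
by rewrite hd div1r.
Qed.

Lemma mob_invl (R : realType) (a b c d : int) (x : R) : a * d - b * c = 1 ->
  c%:~R * x + d%:~R != 0 -> mob d (- b) (- c) a (mob a b c d x) = x.
Proof.
move=> h hx; have hd := @det_real R _ _ _ _ h; rewrite /mob !rmorphN/=.
have E : - c%:~R * ((a%:~R * x + b%:~R) / (c%:~R * x + d%:~R)) + a%:~R
  = (a%:~R * d%:~R - b%:~R * c%:~R) / (c%:~R * x + d%:~R) by field.
rewrite hd div1r in E.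
rewrite E invrK.
transitivity (x * (a%:~R * d%:~R - b%:~R * c%:~R)); last by rewrite hd mulr1.
by field.
Qed.

Lemma rational_mob (R : realType) (a b c d : int) (x : R) :
  rational x -> rational (mob a b c d x).
Proof.
move=> [q _ <-]; exists ((a%:~R * q + b%:~R) / (c%:~R * q + d%:~R)) => //.
by rewrite fmorph_div/= !rmorphD/= !rmorphM/= !ratr_int.
Qed.

(** SL2(Z) acts transitively on the rational points and infinity, by Bezout. *)
Lemma rational_cusp (R : realType) (x : R) : rational x ->
  exists a b c d : int, [/\ a * d - b * c = 1, 0 < c & x = a%:~R / c%:~R].
Proof.
move=> [q _ <-].
have /coprimezP[[u v] /= uv] : coprimez (numq q) (denq q).
  by rewrite /coprimez /gcdz; have := coprime_num_den q; rewrite /coprime => /eqP ->.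
exists (numq q), (- v), (denq q), u; split; first by rewrite -uv; ring.
  exact: denq_gt0.
by rewrite -{1}(divq_num_den q) fmorph_div/= !ratr_int.
Qed.

(** * Separated families of conjugate pairs *)

(** The quantity whose lower limit defines [approx_const], for an arbitrary
conjugation [s]. *)
Definition approx (R : realType) (s : R -> R) (x b : R) : R :=
  2 * (`|x - b| / `|b - s b|).

Arguments approx {R}.

(** What the construction uses of the set Theta and of conjugation on it; [Dl] stands
for the discriminant. *)
Record quadratic_family (R : realType) (T : set R) (s : R -> R) (Dl : R) : Prop := {
  qf_disc : 1 <= Dl;
  qf_conj : forall b, T b -> T (s b);
  qf_conjK : forall b, T b -> s (s b) = b;
  qf_irr : forall b, T b -> irrational b;
  qf_mob : forall p q r t : int, p * t - q * r = 1 -> forall b, T b ->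
    T (mob p q r t b) /\ s (mob p q r t b) = mob p q r t (s b);
  qf_diam : forall b, T b -> 0 < `|b - s b| <= Dl;
  qf_sep : forall b b', T b -> T b' -> b != b' ->
    Num.min `|b - s b| `|b' - s b'| <= 6 * Dl * `|b - b'|;
  qf_rat : forall b, T b -> forall p q : int, q != 0 ->
    `|b - s b| <= Dl * q%:~R ^+ 2 *
       (`|p%:~R / q%:~R - b| * `|p%:~R / q%:~R - s b|) }.

Arguments quadratic_family {R}.
Arguments qf_disc {R T s Dl}.
Arguments qf_conj {R T s Dl}.
Arguments qf_conjK {R T s Dl}.
Arguments qf_irr {R T s Dl}.
Arguments qf_mob {R T s Dl}.
Arguments qf_diam {R T s Dl}.
Arguments qf_sep {R T s Dl}.
Arguments qf_rat {R T s Dl}.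

(** If x and y are at a distance [L] much larger than the diameter [D] of a pair
(b, b'), then y is far from b or x is far from b'. With p = |y - b| and
q = |x - b'| one of p / L, q / L is then close to 1, and p q / L is about
the other factor, unless both p and q are large compared with [Dl]. *)
Lemma cusp_excursion (R : realType) (p q D Dl L l t l' : R) :
  0 <= p -> 0 <= q -> 0 < D -> D <= Dl -> L <= p + q + D ->
  l * D <= 2 * q -> t * D <= 2 * p -> 0 < l' -> l' < l -> l' < t -> l' <= 1 ->
  6 * Dl <= L -> 5 * Dl * l <= L * (l - l') -> 5 * Dl * t <= L * (t - l') ->
  l' * (L * D) <= 2 * (p * q).
Proof.
move=> p0 q0 D0 DDl Lpq lq tp l'0 l'l l't l'1 L1 L2 L3.
have Dl0 : 0 < Dl by apply: lt_le_trans DDl.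
have LD0 : 0 < L by lra.
have [q4|q4] := ltP q (4 * Dl).
  have h1 : L - 5 * Dl <= p by lra.
  have h2 : (L - 5 * Dl) * (l * D) <= p * (2 * q).
    by apply: ler_pM => //; [lra|apply: mulr_ge0; lra].
  have h3 : l' * L * D <= (L * l - 5 * Dl * l) * D by rewrite ler_wpM2r//; lra.
  lra.
have [p4|p4] := ltP p (4 * Dl).
  have h1 : L - 5 * Dl <= q by lra.
  have h2 : (L - 5 * Dl) * (t * D) <= q * (2 * p).
    by apply: ler_pM => //; [lra|apply: mulr_ge0; lra].
  have h3 : l' * L * D <= (L * t - 5 * Dl * t) * D by rewrite ler_wpM2r//; lra.
  lra.
have h1 : 0 <= (p - 4 * Dl) * (q - 4 * Dl) by apply: mulr_ge0; lra.
have h2 : Dl * (L - Dl) <= Dl * (p + q) by rewrite ler_wpM2l//; lra.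
have h3 : l' * (L * D) <= 1 * (L * Dl) by apply: ler_pM => //; rewrite ?mulr_ge0 ?ler_wpM2l//; lra.
have h5 : 0 < Dl * L by rewrite mulr_gt0.
have h4 : Dl * (6 * Dl) <= Dl * L by rewrite ler_wpM2l//; lra.
lra.
Qed.

(** Here u and v are at a distance [L] comparable to [D0], the diameter of the
central pair, p = |u - b| and q = |v - b'|. A small pair (b, b') is far from one
of u, v, and the other is outside the ball around it. A large one is at distance
at least [z] from both by separation from the central pair. *)
Lemma pair_excursion (R : realType) (p q D L D0 c0 z : R) :
  0 <= p -> 0 <= q -> 0 < D -> 0 < D0 -> 0 < z -> 0 < c0 ->
  L <= p + q + D -> D <= p + q + L -> D0 / 2 <= L -> L <= 2 * D0 ->
  (D < D0 -> 2 * c0 * D <= p /\ 2 * c0 * D <= q) ->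
  (D0 / 4 <= D -> z <= p /\ z <= q) ->
  4 * c0 * D0 ^+ 2 <= z ^+ 2 -> 4 * c0 * D0 <= z ->
  c0 * (L * D) <= 2 * (p * q).
Proof.
move=> p0 q0 D_0 D00 z0 c00 t1 t2 L1 L2 h1 h2 e1 e2.
have cD0 : 0 < c0 * D by rewrite mulr_gt0.
have [DL|DL] := ltP D (L / 2).
  have [|a1 a2] := h1; first by lra.
  have [pL|pL] := leP (L / 4) p.
    have : (L / 4) * (2 * c0 * D) <= p * q by apply: ler_pM => //; lra.
    lra.
  have : (L / 4) * (2 * c0 * D) <= q * p by apply: ler_pM => //; lra.
  lra.
have [|zp zq] := h2; first by lra.
have [DL2|DL2] := leP D (2 * L).
  have : z * z <= p * q by apply: ler_pM => //; lra.
  have : c0 * (L * D) <= c0 * ((2 * D0) * (4 * D0)).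
    by apply: (ler_wpM2l (ltW c00)); apply: ler_pM; lra.
  lra.
have LD : c0 * (L * D) <= c0 * (2 * D0 * D).
  by apply: (ler_wpM2l (ltW c00)); apply: (ler_wpM2r (ltW D_0)); lra.
have zD : 4 * c0 * D0 * D <= z * D by apply: ler_wpM2r => //; exact: ltW.
have [pD|pD] := leP (D / 4) p.
  have : (D / 4) * z <= p * q by apply: ler_pM => //; lra.
  lra.
have : (D / 4) * z <= q * p by apply: ler_pM => //; lra.
lra.
Qed.

(** Solving x y = g^2 (1 + x - y) for y. With u = alpha + x delta and
v = alpha' + y delta, where delta = alpha - alpha', this says that the cross ratio
of (v, u) with respect to alpha is 2 g^2. On [g, 2g] both coordinates have size
g, and x |-> y does not distort lengths by more than a factor 10; this is why
the two obstacle problems can share their intervals. *)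
Lemma conj_param (R : realType) (g : R) (y : R -> R) :
  0 < g -> g <= 1 / 100 -> (forall x, y x = g ^+ 2 * (1 + x) / (x + g ^+ 2)) ->
  (forall x, g <= x -> x <= 2 * g ->
     [/\ 0 < y x, y x <= 2 * g & x * y x = g ^+ 2 * (1 + x - y x)]) /\
  (forall x x', g <= x -> x <= 2 * g -> g <= x' -> x' <= 2 * g ->
     1 / 10 * `|x - x'| <= `|y x - y x'| <= `|x - x'|).
Proof.
move=> g0 g1 yE.
have gg : g * g <= g * (1 / 100) by rewrite ler_wpM2l// ltW.
have gg0 : 0 < g * g by rewrite mulr_gt0.
split=> [x x1 x2|x x' x1 x2 x'1 x'2].
  have d0 : 0 < x + g ^+ 2 by lra.
  have dN : x + g ^+ 2 != 0 by rewrite gt_eqF.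
  rewrite yE; split.
  - by rewrite divr_gt0// mulr_gt0//; lra.
  - rewrite ler_pdivrMr//.
    have : g ^+ 2 * x <= g ^+ 2 * (2 * g) by rewrite ler_wpM2l//; lra.
    have : g * g <= g * x by rewrite ler_wpM2l//; lra.
    have : g * (g * g) <= (1 / 100) * (g * g) by rewrite ler_wpM2r//; lra.
    lra.
  - by field.
have d0 : 0 < x + g ^+ 2 by lra.
have d0' : 0 < x' + g ^+ 2 by lra.
have -> : y x - y x' = g ^+ 2 * (1 - g ^+ 2) / ((x + g ^+ 2) * (x' + g ^+ 2)) * (x' - x).
  by rewrite !yE; field; rewrite !gt_eqF.
rewrite normrM [`|x' - x|]distrC.
have dd0 : 0 < (x + g ^+ 2) * (x' + g ^+ 2) by rewrite mulr_gt0.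
have n0 : 0 < g ^+ 2 * (1 - g ^+ 2) by rewrite mulr_gt0//; lra.
rewrite gtr0_norm ?divr_gt0//.
have up : (x + g ^+ 2) * (x' + g ^+ 2) <= (3 * g) * (3 * g) by apply: ler_pM; lra.
have lo : g * g <= (x + g ^+ 2) * (x' + g ^+ 2) by apply: ler_pM; lra.
have gggg : (g * g) * (g * g) <= (g * g) * (1 / 100) by rewrite ler_wpM2l//; lra.
have gggg0 : 0 < (g * g) * (g * g) by rewrite mulr_gt0.
apply/andP; split.
  by rewrite ler_wpM2r// ler_pdivlMr//; lra.
by rewrite -[leRHS]mul1r ler_wpM2r// ler_pdivrMr//; lra.
Qed.

(** The equation says that the cross ratio of the exact pair is t + e / 2; moving both
points by [eta] keeps it between t and t + e. *)
Lemma pair_perturbation (R : realType) (A B L0 A' B' L D0 eta t e : R) :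
  0 <= A -> 0 <= B -> 0 <= A' -> 0 <= B' -> 0 < D0 -> 0 < eta -> 0 < t -> 0 < e ->
  A <= A' + eta -> A' <= A + eta -> B <= B' + eta -> B' <= B + eta ->
  L <= L0 + 2 * eta -> L0 <= L + 2 * eta -> A <= D0 / 4 -> B <= D0 / 4 ->
  t <= 1 / 2 -> e <= 1 / 2 -> 100 * eta = e * D0 -> 9 / 10 * D0 <= L0 ->
  2 * (A * B) = (t + e / 2) * (L0 * D0) ->
  t * (L * D0) <= 2 * (A' * B') < (t + e) * (L * D0).
Proof.
move=> A0 B0 A'0 B'0 D00 eta0 t0 e0 h1 h2 h3 h4 l1 l2 AD BD t1 e1 etaE L1 AB.
have eD0 : e * D0 <= 1 / 2 * D0 by apply: ler_wpM2r => //; exact: ltW.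
have eD : 100 * (eta * D0) = e * D0 * D0 by rewrite mulrA etaE.
have AB1 : A * B <= A' * B' + eta * D0.
  have h : A * B <= (A' + eta) * (B' + eta) by apply: ler_pM.
  have h' : eta * (A' + B' + eta) <= eta * D0 by apply: (ler_wpM2l (ltW eta0)); lra.
  by clear -h h'; lra.
have AB2 : A' * B' <= A * B + eta * D0.
  have h : A' * B' <= (A + eta) * (B + eta) by apply: ler_pM.
  have h' : eta * (A + B + eta) <= eta * D0 by apply: (ler_wpM2l (ltW eta0)); lra.
  by clear -h h'; lra.
have etaD0 : 0 < eta * D0 by rewrite mulr_gt0.
have eL : 9 / 10 * (e * D0 * D0) <= e * (L0 * D0).
  have : e * D0 * (9 / 10 * D0) <= e * D0 * L0.
    by apply: ler_wpM2l => //; rewrite ltW// mulr_gt0.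
  by clear; lra.
have tD : t * (eta * D0) <= 1 / 2 * (eta * D0) by apply: ler_wpM2r => //; exact: ltW.
have eD1 : e * (eta * D0) <= 1 / 2 * (eta * D0) by apply: ler_wpM2r => //; exact: ltW.
have tL : t * D0 * L <= t * D0 * (L0 + 2 * eta).
  by apply: ler_wpM2l => //; rewrite ltW// mulr_gt0.
have tL' : (t + e) * D0 * L0 <= (t + e) * D0 * (L + 2 * eta).
  by apply: ler_wpM2l => //; rewrite mulr_ge0// ?addr_ge0// ltW.
clear -AB1 AB2 AB eD eL tD eD1 tL tL' etaD0.
by apply/andP; split; lra.
Qed.

(** The sizes used in [prescribed_min]: [g] for the distance of u, v to alpha, alpha'
in units of [D0], [eta] for the rational approximation, and [z] for the distance
to all other large pairs that separation guarantees. *)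
Lemma scale_choice (R : realType) (Dl t e D0 : R) : 1 <= Dl -> 0 < t ->
  10 ^+ 6 * (Dl ^+ 2 * t) <= 1 -> 0 < e -> 0 < D0 ->
  exists e1 g eta z : R,
   [/\ [/\ 0 < e1, e1 <= e, e1 <= 1 / 2, t <= 1 / 2 & 2 * g ^+ 2 = t + e1 / 2],
     [/\ 0 < g, 10 ^+ 3 * Dl * g <= 1 & 2 * g * D0 <= D0 / 4],
     [/\ 0 < eta, 100 * eta = e1 * D0, eta <= D0 / 10 & 2 * g * D0 + eta <= z] &
     [/\ 0 < z, 48 * Dl * z = D0, 4 * t * D0 ^+ 2 <= z ^+ 2 & 4 * t * D0 <= z]].
Proof.
move=> Dl1 t0 tDl e0 D00.
have Dlt : Dl * t <= Dl ^+ 2 * t.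
  by rewrite expr2 -mulrA -[leLHS]mul1r; apply: ler_wpM2r => //; rewrite mulr_ge0//; lra.
have tDlt : t <= Dl * t by rewrite -[leLHS]mul1r; apply: ler_wpM2r => //; lra.
have [e1 [e10 e1e e1t]] : exists e1 : R, [/\ 0 < e1, e1 <= e & e1 <= t].
  by exists (Num.min e t); rewrite lt_min e0 t0 !ge_min !lexx orbT.
have [g [g0 g2]] : exists g : R, 0 < g /\ 2 * g ^+ 2 = t + e1 / 2.
  exists (Num.sqrt ((t + e1 / 2) / 2)); rewrite sqrtr_gt0 sqr_sqrtr; [split|]; lra.
have gDl : 10 ^+ 3 * Dl * g <= 1.
  rewrite leNgt; apply/negP => h.
  have : 1 * 1 < (10 ^+ 3 * Dl * g) * (10 ^+ 3 * Dl * g) by apply: ltr_pM.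
  have -> : (10 ^+ 3 * Dl * g) * (10 ^+ 3 * Dl * g) =
    10 ^+ 6 * (Dl ^+ 2 * (2 * g ^+ 2)) / 2 by field.
  rewrite g2.
  have : Dl ^+ 2 * e1 <= Dl ^+ 2 * t by rewrite ler_wpM2l// sqr_ge0.
  by move: tDl; clear; lra.
have [z [z0 zE]] : exists z : R, 0 < z /\ 48 * Dl * z = D0.
  exists (D0 / (48 * Dl)); split; first by rewrite divr_gt0//; lra.
  by field; lra.
have e1Dl : Dl * e1 <= Dl * t by apply: ler_wpM2l => //; lra.
exists e1, g, (e1 * D0 / 100), z.
have gz : 10 ^+ 3 * Dl * g * z <= 1 * z by apply: ler_wpM2r => //; exact: ltW.
have ez : Dl * e1 * z <= 1 / 10 ^+ 6 * z by apply: ler_wpM2r; [exact: ltW|lra].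
have zD : 1 * z <= Dl * z by apply: ler_wpM2r => //; exact: ltW.
have eta0 : 0 < e1 * D0 / 100 by rewrite divr_gt0// mulr_gt0.
have tz : Dl ^+ 2 * t * z ^+ 2 <= 1 / 10 ^+ 6 * z ^+ 2 by apply: ler_wpM2r; [exact: sqr_ge0|lra].
have tz' : Dl * t * z <= 1 / 10 ^+ 6 * z by apply: ler_wpM2r; [exact: ltW|lra].
have z20 : 0 < z ^+ 2 by rewrite exprn_gt0.
split; split => //; try lra; rewrite -zE.
- by clear -gz zD z0; lra.
- by clear -ez zD z0; lra.
- by clear -gz ez z0; lra.
- by clear -tz z20; lra.
- by clear -tz' z0; lra.
Qed.

Section Family.
Variables (R : realType) (T : set R) (s : R -> R) (Dl : R).
Hypothesis fam : quadratic_family T s Dl.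

Lemma diam_gt0 b : T b -> 0 < `|b - s b|.
Proof. by move=> /(qf_diam fam)/andP[]. Qed.

Lemma approx_ge l x b : T b -> (l <= approx s x b) = (l * `|b - s b| <= 2 * `|x - b|).
Proof. by move=> /diam_gt0 h; rewrite /approx mulrA ler_pdivlMr. Qed.

Lemma approx_lt l x b : T b -> (approx s x b < l) = (2 * `|x - b| < l * `|b - s b|).
Proof. by move=> /diam_gt0 h; rewrite /approx mulrA ltr_pdivrMr. Qed.

Lemma diam_conj b : T b -> `|s b - s (s b)| = `|b - s b|.
Proof. by move=> /(qf_conjK fam) ->; rewrite distrC. Qed.

Lemma den_neq0 (p q r t : int) b : p * t - q * r = 1 -> T b ->
  r%:~R * b + t%:~R != 0 /\ r%:~R * s b + t%:~R != 0.
Proof.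
move=> h Tb; split; apply: irrational_den h; apply: (qf_irr fam) => //.
exact: (qf_conj fam).
Qed.

Lemma diam_mob (p q r t : int) b : p * t - q * r = 1 -> T b ->
  let g := mob p q r t in
  `|g b - s (g b)| = `|b - s b| / (`|r%:~R * b + t%:~R| * `|r%:~R * s b + t%:~R|).
Proof.
move=> h Tb g; have [_ ->] := qf_mob fam _ _ _ _ h _ Tb.
have [n1 n2] := den_neq0 _ _ _ _ _ h Tb.
by rewrite /g mob_sub// normrM normfV normrM.
Qed.

(** The factor on the right is |b' - x0| / |x - x0| with x0 the preimage of infinity:
the identity says that the cross ratio of infinity and the image of x is that of
x0 and x. *)
Lemma approx_mob (p q r t : int) x b : p * t - q * r = 1 -> T b ->
  r%:~R * x + t%:~R != 0 ->
  approx s (mob p q r t x) (mob p q r t b) =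
    approx s x b * (`|r%:~R * s b + t%:~R| / `|r%:~R * x + t%:~R|).
Proof.
move=> h Tb hx; rewrite /approx diam_mob//.
have [n1 n2] := den_neq0 _ _ _ _ _ h Tb.
rewrite mob_sub// normrM normfV normrM.
by field; rewrite !normr_eq0 hx n1 n2 -normr_eq0 gt_eqF// diam_gt0.
Qed.

(** The case x = infinity of [approx_mob]. *)
Lemma approx_mob_cusp (p q r t : int) b : p * t - q * r = 1 -> r != 0 -> T b ->
  approx s (p%:~R / r%:~R) (mob p q r t b) =
    2 * (`|r%:~R * s b + t%:~R| / (`|r%:~R : R| * `|b - s b|)).
Proof.
move=> h r0 Tb; rewrite /approx diam_mob//.
have [n1 n2] := den_neq0 _ _ _ _ _ h Tb.
rewrite mob_cusp_sub// normfV normrM.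
by field; rewrite !normr_eq0 intr_eq0 r0 n1 n2 -normr_eq0 gt_eqF// diam_gt0.
Qed.

Lemma family_preimage (p q r t : int) b : p * t - q * r = 1 -> T b ->
  exists2 b', T b' & b = mob p q r t b'.
Proof.
move=> h Tb.
have h' : t * p - (- q) * (- r) = 1 by rewrite -h; ring.
have [Tb' _] := qf_mob fam _ _ _ _ h' _ Tb.
exists (mob t (- q) (- r) p b) => //.
have [n1 _] := den_neq0 _ _ _ _ _ h' Tb.
by have := mob_invl _ _ _ _ _ _ h' n1; rewrite !opprK.
Qed.

Lemma family_translate (z : int) b : T b ->
  T (b + z%:~R) /\ s (b + z%:~R) = s b + z%:~R.
Proof.
have h : 1 * 1 - z * 0 = 1 :> int by rewrite mulr0 subr0.
have E x : mob 1 z 0 1 x = x + z%:~R by rewrite /mob mul1r mul0r add0r divr1.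
by move=> Tb; have := qf_mob fam _ _ _ _ h _ Tb; rewrite !E.
Qed.

(** * Gluing rational points at a cusp *)

Definition nearly_min (t e m : R) :=
  (forall b, T b -> t <= approx s m b) /\ exists2 b, T b & approx s m b < t + e.

(** The point P is the image of infinity under some h in SL2(Z). The new point is
h(m + N), where m is a rational point with least constant slightly above [l'].
For large N it is close to P, its constants are controlled by those of P and m,
and the pair that is nearly optimal for m becomes a small pair. *)
Lemma cusp_step (tau : R) : tau <= 1 ->
  (forall t e : R, 0 < t -> t <= tau -> 0 < e ->
     exists2 m, rational m & nearly_min t e m) ->
  forall (P l l' : R), rational P -> (forall b, T b -> l <= approx s P b) ->
  0 < l' -> l' < l -> l' < tau -> forall rho e : R, 0 < rho -> 0 < e ->
  exists P', [/\ rational P', `|P' - P| < rho,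
    forall b, T b -> l' <= approx s P' b &
    exists2 b, T b & `|b - s b| < e /\ approx s P' b < l' + e].
Proof.
move=> tau1 hK P l l' Prat hP l'0 l'l l'tau rho e rho0 e0.
have Dl1 := qf_disc fam.
have [a [b [c [d [det c0 PE]]]]] := rational_cusp _ _ Prat.
have c0' : c != 0 by rewrite gt_eqF.
have [cr crE] : exists cr : R, cr = c%:~R by eexists.
have cr1 : 1 <= cr by rewrite crE -[1]/(1%:~R) ler_int -gtz0_ge1.
have cr0 : 0 < cr by lra.
have crN0 : cr != 0 by rewrite gt_eqF.
have crn : `|cr| = cr by rewrite gtr0_norm.
have [t [l't ttau te]] : exists t, [/\ l' < t, t <= tau & t < l' + e].
  exists (Num.min tau (l' + e / 2)); split.
  - by rewrite lt_min l'tau; lra.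
  - by rewrite ge_min lexx.
  - by rewrite gt_min; apply/orP; right; lra.
have [|||m mrat [mge [b1 Tb1 mb1]]] := hK t (l' + e - t); [by lra|by []|by lra|].
rewrite (_ : t + (l' + e - t) = l' + e) in mb1; last by ring.
have [x0 affE] : exists x0 : R, forall x, c%:~R * x + d%:~R = cr * (x - x0).
  by exists (- (d%:~R / cr)) => x; rewrite -crE; field.
have [M [M0 b1M sb1M mM]] : exists M : R,
    [/\ 0 <= M, `|b1 - x0| <= M, `|s b1 - x0| <= M & `|m - x0| <= M].
  exists (`|b1 - x0| + `|s b1 - x0| + `|m - x0|).
  have h1 := normr_ge0 (b1 - x0); have h2 := normr_ge0 (s b1 - x0).
  by have h3 := normr_ge0 (m - x0); clear -fam h1 h2 h3; split; lra.
have [A AE] : exists A, A = approx s m b1 by eexists.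
rewrite -AE in mb1.
have A0 : 0 <= A by rewrite AE /approx !mulr_ge0// invr_ge0.
have [D1 D1E] : exists D1, D1 = `|b1 - s b1| by eexists.
have D10 : 0 < D1 by rewrite D1E; apply: diam_gt0.
have lpos : 0 < l - l' by lra.
have tpos : 0 < t - l' by lra.
have gpos : 0 < l' + e - A by rewrite subr_gt0.
have [K [K1 Krho Ke KA KL]] : exists K : R, [/\ 1 <= K, 1 < K * rho, D1 < K * e,
    2 * M * A < K * (l' + e - A) & [/\ 6 * Dl <= K,
    5 * Dl * l <= K * (l - l') & 5 * Dl * t <= K * (t - l')]].
  have big (x y : R) : 0 < y -> exists2 K0 : R, 0 <= K0 & forall K : R, K0 <= K -> x < K * y.
    move=> y0; exists (`|x / y| + 1); first by rewrite addr_ge0.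
    move=> K hK'; rewrite -ltr_pdivrMr//.
    by have := ler_norm (x / y); lra.
  have [k1 p1 h1] := big 1 rho rho0.
  have [k2 p2 h2] := big D1 e e0.
  have [k3 p3 h3] := big (2 * M * A) _ gpos.
  have [k4 p4 h4] := big (5 * Dl * l) _ lpos.
  have [k5 p5 h5] := big (5 * Dl * t) _ tpos.
  clear -fam p1 p2 p3 p4 p5 h1 h2 h3 h4 h5 Dl1.
  exists (6 * Dl + k1 + k2 + k3 + k4 + k5).
  split; first by lra.
  - by apply: h1; lra.
  - by apply: h2; lra.
  - by apply: h3; lra.
  - by split; [lra|apply: ltW; apply: h4; lra|apply: ltW; apply: h5; lra].
have K0 : 0 < K by clear -fam K1; lra.
have [N hN] : exists N : nat, M + K <= N%:R.
  exists (Num.bound `|M + K|); apply: le_trans (ler_norm _) _.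
  exact/ltW/archi_boundP.
have far x : `|x - x0| <= M -> K <= `|x + N%:R - x0|.
  move=> hx; have h := ler_normB (x + N%:R - x0) (x - x0).
  rewrite (_ : x + N%:R - x0 - (x - x0) = N%:R) in h; last by ring.
  by rewrite normr_nat in h; clear -fam hx hN h; lra.
have NE : N%:R = (N : int)%:~R :> R by [].
have [y yE] : exists y, y = m + N%:R by eexists.
have [L LE] : exists L, L = `|y - x0| by eexists.
have KL' : K <= L by rewrite LE yE; exact: far.
have L0 : 0 < L by exact: lt_le_trans K0 KL'.
have LN0 : L != 0 by rewrite gt_eqF.
have ynz : c%:~R * y + d%:~R != 0.
  by rewrite affE mulf_neq0// -normr_eq0 -LE.
exists (mob a b c d y); split.
- apply: rational_mob; case: mrat => q _ qm; exists (q + N%:R) => //.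
  by rewrite yE rmorphD/= ratr_nat qm.
- rewrite distrC PE mob_cusp_sub// normfV normrM affE normrM -LE -crE crn.
  have h : K <= cr * (cr * L).
    clear -fam K1 cr1 KL'.
    by rewrite -[K]mul1r ler_pM//; [lra|]; rewrite -[K]mul1r ler_pM//; lra.
  apply: (@le_lt_trans _ _ K^-1).
    by rewrite lef_pV2 ?posrE//; exact: lt_le_trans K0 h.
  by rewrite -div1r ltr_pdivrMr// mulrC.
- move=> _ /(family_preimage _ _ _ _ _ det)[b2 Tb2 ->].
  rewrite approx_mob//.
  have := hP _ (qf_mob fam _ _ _ _ det _ Tb2).1.
  rewrite PE approx_mob_cusp// affE normrM => hl.
  have [Tb3 sb3] := family_translate (- (N : int)) _ Tb2.
  have := mge _ Tb3; rewrite approx_ge// sb3.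
  rewrite (_ : _ + _ - (_ + _) = b2 - s b2); last by ring.
  rewrite (_ : m - _ = y - b2); last by rewrite yE rmorphN NE; ring.
  have D0 := diam_gt0 _ Tb2.
  have /andP[_ DDl] := qf_diam fam _ Tb2.
  have DN0 : `|b2 - s b2| != 0 by rewrite gt_eqF.
  move=> ht; rewrite !affE !normrM -LE crn.
  rewrite (_ : approx s y b2 * _ = 2 * (`|y - b2| * `|s b2 - x0|) / (L * `|b2 - s b2|)); last first.
    by rewrite /approx; field; rewrite DN0 LN0 crN0.
  rewrite ler_pdivlMr ?mulr_gt0//.
  have hl' : l * `|b2 - s b2| <= 2 * `|s b2 - x0|.
    rewrite -ler_pdivlMr//; apply: le_trans hl _; rewrite -crE crn.
    by rewrite le_eqVlt; apply/orP; left; apply/eqP; field; rewrite DN0 crN0.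
  case: KL => k6 k7 k8.
  apply: (cusp_excursion _ _ _ _ Dl _ l t) => //.
  + have h1 := ler_distD b2 y x0; have h2 := ler_distD (s b2) b2 x0.
    by rewrite LE; clear -fam h1 h2; lra.
  + by clear -fam l'tau tau1; lra.
  + by clear -fam k6 KL'; lra.
  + by apply: le_trans k7 _; rewrite ler_wpM2r// ltW.
  + by apply: le_trans k8 _; rewrite ler_wpM2r// ltW.
have [Tb2 sb2] := family_translate (N : int) _ Tb1.
exists (mob a b c d (b1 + N%:R)); first by have [] := qf_mob fam _ _ _ _ det _ Tb2.
have q1 : K <= `|b1 + N%:R - x0| by exact: far.
have q2 : K <= `|s b1 + N%:R - x0| by exact: far.
split.
  rewrite diam_mob// !affE sb2 !normrM crn.
  rewrite (_ : _ - (_ + _) = b1 - s b1); last by rewrite NE; ring.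
  rewrite -D1E.
  apply: (@le_lt_trans _ _ (D1 / K)); last by rewrite ltr_pdivrMr// mulrC.
  have h : K <= (cr * `|b1 + N%:~R - x0|) * (cr * `|s b1 + N%:~R - x0|).
    rewrite -NE; clear -fam cr1 K1 q1 q2.
    have z1 : 1 * K <= cr * `|b1 + N%:R - x0| by apply: ler_pM => //; lra.
    have z2 : 1 * 1 <= cr * `|s b1 + N%:R - x0| by apply: ler_pM => //; lra.
    have : (1 * K) * (1 * 1) <= (cr * `|b1 + N%:R - x0|) * (cr * `|s b1 + N%:R - x0|).
      by apply: ler_pM => //; lra.
    lra.
  by rewrite ler_pM2l// lef_pV2 ?posrE//; exact: lt_le_trans K0 h.
rewrite approx_mob// !affE sb2 !normrM crn -LE.
have -> : approx s y (b1 + N%:~R) = A.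
  rewrite AE /approx sb2 yE (_ : m + _ - _ = m - b1); last by rewrite NE; ring.
  by rewrite (_ : b1 + _ - _ = b1 - s b1); last by ring.
have -> : A * (cr * `|s b1 + N%:~R - x0| / (cr * L)) = A * `|s b1 + N%:~R - x0| / L.
  by field; rewrite LN0 crN0.
rewrite ltr_pdivrMr//.
have h1 : `|s b1 + N%:~R - x0| <= L + 2 * M.
  have -> : s b1 + N%:~R - x0 = (s b1 - x0) + (y - x0) - (m - x0) by rewrite yE NE; ring.
  apply: le_trans (ler_normB _ _) _; have h := ler_normD (s b1 - x0) (y - x0).
  by rewrite -LE in h; clear -fam h sb1M mM; lra.
have h2 : A * `|s b1 + N%:~R - x0| <= A * (L + 2 * M) by rewrite ler_wpM2l.
have h3 : K * (l' + e - A) <= L * (l' + e - A) by rewrite ler_wpM2r// ltW.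
by clear -fam h2 h3 KA; lra.
Qed.

(** Iteration of [cusp_step] with the bounds c + (tau / 2) 16^-k. Each new point
is the centre of a ball, inside the previous one, on which one pair of diameter
below 16^-k keeps its constant below c + 3 16^-k. The limit is neither rational nor
in [T], since there small pairs have constants bounded below by 1 / 2 and tau. *)
Lemma spectrum_of_steps (tau c P0 : R) : 0 < tau -> 0 <= c -> 2 * c <= tau ->
  12 * Dl * tau <= 1 ->
  rational P0 -> (forall b, T b -> tau <= approx s P0 b) ->
  (forall (P l l' : R), rational P -> (forall b, T b -> l <= approx s P b) ->
   0 < l' -> l' < l -> l' < tau -> forall rho e : R, 0 < rho -> 0 < e ->
   exists P', [/\ rational P', `|P' - P| < rho,
    forall b, T b -> l' <= approx s P' b &
    exists2 b, T b & `|b - s b| < e /\ approx s P' b < l' + e]) ->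
  exists xi, [/\ ~ rational xi, ~ T xi, forall b, T b -> c <= approx s xi b &
    forall e : R, 0 < e -> exists2 b, T b & `|b - s b| < e /\ approx s xi b < c + e].
Proof.
move=> tau0 c0 ctau tauDl P0rat hP0 step.
have Dl1 := qf_disc fam.
have [w wE] : exists w : nat -> R, w = fun k => 1 / 16 ^+ k by eexists.
have w0 k : 0 < w k by rewrite wE divr_gt0// exprn_gt0.
have wS k : w k.+1 = w k / 16.
  by rewrite wE exprS; field; rewrite expf_neq0// pnatr_eq0.
have w_0 : w 0%N = 1 by rewrite wE expr0 divr1.
have w1 k : w k <= 1.
  elim: k => [|k IH]; first by rewrite w_0.
  by rewrite wS; have := w0 k; lra.
have [l lE] : exists l : nat -> R, forall k, l k = c + tau / 2 * w k by eexists.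
have lS k : l k.+1 < l k by rewrite !lE wS ltrD2l ltr_pM2l; have := w0 k; lra.
have lc k : c < l k by rewrite lE ltrDl mulr_gt0//; lra.
have ltau k : l k <= tau by rewrite lE; have := ler_wpM2l (ltW tau0) (w1 k); lra.
have lw k : l k <= c + w k.
  rewrite lE lerD2l; have : tau / 2 <= 1.
    have : tau * 1 <= tau * Dl by rewrite ler_wpM2l// ltW.
    lra.
  by move=> h; rewrite -[leRHS]mul1r ler_wpM2r// ltW.
pose Pk k (z : R * R) := [/\ rational z.1, 0 < z.2, z.2 <= w k &
  forall b, T b -> l k <= approx s z.1 b].
pose Qk k (z z' : R * R) := `|z'.1 - z.1| <= z.2 - z'.2 /\
  exists2 b, T b & forall x, `|x - z'.1| <= z'.2 -> `|b - s b| < w k /\ approx s x b < c + 3 * w k.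
have [||f [f0 fP fQ]] := dep_choice _ Pk Qk (P0, 1).
- rewrite /Pk /= w_0; split => // b Tb; exact: le_trans (ltau _) (hP0 _ Tb).
- move=> k [P r] [/= Prat r0 rw hP].
  have [|||P' [P'rat PP' hP' [b Tb [Db Pb]]]] :=
    step P (l k) (l k.+1) Prat hP _ (lS k) _ (r / 2) (w k) _ (w0 k).
  + by apply: le_lt_trans (lc _).
  + by apply: lt_le_trans (ltau k).
  + by lra.
  have D0 := diam_gt0 _ Tb.
  have [r' [r'0 r'w r'r r'b]] : exists r' : R, [/\ 0 < r', r' <= w k.+1, r' <= r / 2
      & r' <= w k * `|b - s b| / 2].
    exists (Num.min (w k.+1) (Num.min (r / 2) (w k * `|b - s b| / 2))).
    by rewrite !lt_min w0/= !divr_gt0 ?mulr_gt0// !ge_min !lexx !orbT.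
  exists (P', r'); split; first by [].
  split=> /=; first by lra.
  exists b => // x hx; split => //.
  rewrite approx_lt// in Pb; rewrite approx_lt//.
  have := ler_distD P' x b.
  have := lw k.+1; rewrite wS => h.
  have : l k.+1 * `|b - s b| <= (c + w k / 16) * `|b - s b| by rewrite ler_wpM2r// ltW.
  have : 0 < w k * `|b - s b| by rewrite mulr_gt0.
  lra.
have [|k|xi hxi] := nested_balls _ (fun k => (f k).1) (fun k => (f k).2).
- by move=> k; have [] := fQ k.
- by apply: ltW; have [] := fP k.
have small e : 0 < e -> exists k, w k < e by rewrite wE; exact: small_geometric.
have lower b : T b -> c <= approx s xi b.
  move=> Tb; rewrite approx_ge// leNgt; apply/negP => h.
  have [|k hk] := small ((c * `|b - s b| - 2 * `|xi - b|) / 2) _; first by lra.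
  have [_ _ fw fl] := fP k.
  have := fl b Tb; rewrite approx_ge//.
  have := hxi k; have := ler_distD xi (f k).1 b; rewrite [`|(f k).1 - xi|]distrC.
  have : c * `|b - s b| <= l k * `|b - s b| by rewrite ler_wpM2r// ltW.
  lra.
have upper e : 0 < e -> exists2 b, T b & `|b - s b| < e /\ approx s xi b < c + e.
  move=> e0; have [|k hk] := small (e / 3) _; first by lra.
  have [_ [b Tb hb]] := fQ k; exists b => //.
  by have [h1 h2] := hb xi (hxi k.+1); have := w0 k; split; lra.
have tau1 : tau <= 1 / 12.
  have : tau * 1 <= tau * Dl by rewrite ler_wpM2l// ltW.
  lra.
exists xi; split => //.
- move=> /(rational_cusp _ _)[p [_ [q [_ [_ q0 xiE]]]]].
  have [Q QE] : exists Q : R, Q = Dl * q%:~R ^+ 2 by eexists.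
  have Q0 : 0 < Q by rewrite QE mulr_gt0 ?exprn_gt0 ?ltr0z//; lra.
  have [|b Tb [h1 h2]] := upper (Num.min (1/2) (1 / (2 * Q))).
    by rewrite lt_min !divr_gt0// mulr_gt0.
  have D0 := diam_gt0 _ Tb.
  have q0' : q != 0 by rewrite gt_eqF.
  have := qf_rat fam _ Tb p q q0'; rewrite -xiE -QE.
  move: h1 h2; rewrite lt_min => /andP[_ h1] h2.
  have {}h2 : approx s xi b < c + 1 / 2 by apply: lt_le_trans h2 _; rewrite lerD2l ge_min lexx.
  move: h2; rewrite approx_lt// => h2.
  have h3 : (c + 1/2) * `|b - s b| <= 1 * `|b - s b| by rewrite ler_wpM2r//; lra.
  have := ler_distD b xi (s b) => h4.
  have h5 : `|xi - b| * `|xi - s b| <= (`|b - s b| / 2) * (2 * `|b - s b|).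
    by apply: ler_pM => //; lra.
  apply/negP; rewrite -ltNge.
  apply: (@le_lt_trans _ _ (Q * ((`|b - s b| / 2) * (2 * `|b - s b|)))).
    by rewrite ler_wpM2l// ltW.
  rewrite ltr_pdivlMr ?mulr_gt0// in h1.
  have : `|b - s b| * (`|b - s b| * (2 * Q)) < `|b - s b| * 1 by rewrite ltr_pM2l.
  have : 0 < `|b - s b| * `|b - s b| * Q by exact: mulr_gt0 (mulr_gt0 D0 D0) Q0.
  lra.
- move=> Txi; have Dx0 := diam_gt0 _ Txi.
  have [|b Tb [h1 h2]] := upper (Num.min (tau / 2) (`|xi - s xi|)).
    by rewrite lt_min Dx0 divr_gt0.
  have D0 := diam_gt0 _ Tb.
  move: h1 h2; rewrite lt_min => /andP[_ h1] h2.
  have {}h2 : approx s xi b < tau.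
    by apply: lt_le_trans h2 _; apply: (@le_trans _ _ (c + tau / 2));
      [rewrite lerD2l ge_min lexx|lra].
  move: h2; rewrite approx_lt// => h2.
  have nb : xi != b by apply/eqP => E; rewrite E ltxx in h1.
  have := qf_sep fam _ _ Txi Tb nb; rewrite (min_idPr (ltW h1)) => h3.
  have h4 : 6 * Dl * (2 * `|xi - b|) < 6 * Dl * (tau * `|b - s b|) by rewrite ltr_pM2l//; lra.
  have h5 : 12 * Dl * tau * `|b - s b| <= 1 * `|b - s b| by rewrite ler_wpM2r// ltW.
  lra.
Qed.

(** * Rational points with a prescribed least constant *)

(** Let p/q be a good approximation of u. If p/q were in the small ball around b,
then [qf_rat] would bound 1 / q^2 by a multiple of the radius, so that u would be
in the large ball. *)
Lemma rational_avoid (S : set R) (u c eta : R) : S `<=` T -> 0 <= c -> c <= 1 -> 0 < eta ->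
  (forall b, S b -> (1 + 2 * Dl) * c * `|b - s b| <= `|u - b|) ->
  exists U, [/\ rational U, `|U - u| < eta & forall b, S b -> c * `|b - s b| <= `|U - b|].
Proof.
move=> ST c0 c1 eta0 hu.
have [p [q [q0 h1 h2]]] := rational_approx _ u _ eta0.
exists (p%:~R / q%:~R); split => //.
  by exists (p%:~R / q%:~R) => //; rewrite fmorph_div/= !ratr_int.
move=> b Sb; have Tb := ST b Sb; rewrite leNgt; apply/negP => h.
have D0 := diam_gt0 _ Tb.
have := qf_rat fam _ Tb p q q0.
have Dl1 := qf_disc fam.
have := hu b Sb.
have := ler_distD (p%:~R / q%:~R) u b; rewrite [`|u - p%:~R / q%:~R|]distrC.
move: h h1 h2.
have [P PE] : exists P : R, P = p%:~R / q%:~R by eexists.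
have [Q QE] : exists Q : R, Q = q%:~R ^+ 2 by eexists.
have Q0 : 0 < Q by rewrite QE lt_neqAle sqr_ge0 eq_sym sqrf_eq0 intr_eq0 q0.
rewrite -PE -QE => h h1 h2 t1 h3 h4.
have t2 := ler_distD b P (s b).
have cD : c * `|b - s b| <= 1 * `|b - s b| by rewrite ler_wpM2r.
have h5 : `|P - b| * `|P - s b| <= `|P - b| * (2 * `|b - s b|) by rewrite ler_wpM2l//; lra.
have h6 : `|b - s b| * 1 <= `|b - s b| * (2 * Dl * (Q * `|P - b|)).
  have : (Dl * Q) * (`|P - b| * `|P - s b|) <= (Dl * Q) * (`|P - b| * (2 * `|b - s b|)).
    by rewrite ler_wpM2l// mulr_ge0 ?ltW//; lra.
  lra.
rewrite ler_pM2l// in h6.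
have h7 : Q * ((1 + 2 * Dl) * c * `|b - s b|) <= Q * (`|P - u| + `|P - b|).
  by apply: (ler_wpM2l (ltW Q0)); lra.
have h8 : Q * `|P - b| < Q * (c * `|b - s b|) by rewrite ltr_pM2l.
have h9 : Dl * (Q * `|P - b|) < Dl * (Q * (c * `|b - s b|)) by rewrite ltr_pM2l//; lra.
lra.
Qed.

(** The obstacles are the members of diameter less than [D0]. Those large compared
with g are avoided from the start, because alpha and alpha' are separated from
them; the others are left to [avoid_two]. *)
Lemma real_pair (al t g : R) : T al -> 0 < t -> 10 ^+ 6 * (Dl ^+ 2 * t) <= 1 ->
  0 < g -> 10 ^+ 3 * Dl * g <= 1 ->
  let D0 := `|al - s al| in
  exists u v, [/\ `|u - al| <= 2 * g * D0, `|v - s al| <= 2 * g * D0,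
     `|u - al| * `|v - s al| = g ^+ 2 * (`|u - v| * D0),
     9 / 10 * D0 <= `|u - v| <= 11 / 10 * D0 &
     forall b, T b -> `|b - s b| < D0 ->
       (1 + 2 * Dl) * (2 * t) * `|b - s b| <= `|u - b| /\
       (1 + 2 * Dl) * (2 * t) * `|b - s b| <= `|v - b| ].
Proof.
move=> Tal t0 tDl g0 gDl D0'.
have [D0 D0E] : exists D0, D0 = `|al - s al| by eexists.
rewrite /D0' -D0E.
have D00 : 0 < D0 by rewrite D0E diam_gt0.
have Dl1 := qf_disc fam.
have g1000 : 10 ^+ 3 * g <= 1.
  have : 10 ^+ 3 * g * 1 <= 10 ^+ 3 * g * Dl by rewrite ler_wpM2l//; lra.
  lra.
have [c1 c1E] : exists c1, c1 = (1 + 2 * Dl) * (2 * t) by eexists.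
have c1_ge0 : 0 <= c1 by rewrite c1E mulr_ge0//; lra.
have c1_le : 10 ^+ 5 * (Dl * c1) <= 1.
  have : Dl * t * 1 <= Dl * t * Dl by rewrite ler_wpM2l// mulr_ge0//; lra.
  rewrite c1E; lra.
rewrite -c1E.
clear tDl gDl c1E.
have [y yE] : exists y : R -> R, forall x, y x = g ^+ 2 * (1 + x) / (x + g ^+ 2) by eexists.
have [|ybd ylip] := conj_param _ g y g0 _ yE; first by lra.
pose de := al - s al.
have inI x : `|x - 3 / 2 * g| <= g / 2 -> g <= x /\ x <= 2 * g.
  by rewrite ler_norml => /andP[]; split; lra.
have g20 : 0 < g / 2 by lra.
have k0 : 0 < (6 * Dl)^-1 by rewrite invr_gt0; lra.
have Dl0 : 6 * Dl != 0 by rewrite gt_eqF//; lra.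
have m0 : 0 < D0 / 10 by lra.
have mM : D0 / 10 <= D0 by lra.
pose S : set R := [set b | T b /\ `|b - s b| < D0].
have Tsal := qf_conj fam _ Tal.
have far b a : S b -> T a -> `|a - s a| = D0 -> `|b - s b| <= 6 * Dl * `|b - a|.
  move=> [Tb bD] Ta aD; have nb : b != a by apply/eqP => E; rewrite -E in aD; rewrite aD ltxx in bD.
  by have := qf_sep fam _ _ Tb Ta nb; rewrite aD (min_idPl (ltW bD)).
have start a z b : T a -> `|a - s a| = D0 -> `|z| <= 2 * g -> S b ->
   64 * D0 * (g / 2) < (6 * Dl)^-1 * `|b - s b| -> c1 * `|b - s b| <= `|a + z * de - b|.
  move=> Ta aD hz Sb h.
  have := far b a Sb Ta aD; rewrite -ler_pdivrMl; last lra.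
  move: h.
  have [E EE] : exists E, E = (6 * Dl)^-1 * `|b - s b| by eexists.
  have DE : `|b - s b| = 6 * Dl * E by rewrite EE; field; lra.
  rewrite -EE => h1 h2.
  have E0 : 0 < E by have : 0 < D0 * g; [exact: mulr_gt0|lra].
  have h3 : `|z * de| <= 2 * g * D0 by rewrite normrM /de -D0E ler_wpM2r// ltW.
  have := ler_distD (a + z * de) b a; rewrite (_ : _ + _ - a = z * de); last by ring.
  rewrite [`|b - (_ + _)|]distrC => h4.
  have h5 : c1 * `|b - s b| <= E / 2.
    rewrite DE; have : 10 ^+ 5 * (Dl * c1) * E <= 1 * E by rewrite ler_wpM2r// ltW.
    lra.
  lra.
have [|||||x hx hav] := @avoid_two R S (fun b => `|b - s b|)
   (fun x => al + x * de) (fun x => s al + y x * de)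
   (6 * Dl)^-1 c1 (D0 / 10) D0 (3 / 2 * g) (g / 2) g20 c1_ge0 k0 m0 mM.
- rewrite -(ler_pM2l (x := 6 * Dl)) ?mulrA ?divff//; last lra.
  have : 10 ^+ 5 * (Dl * c1) * D0 <= 1 * D0 by rewrite ler_wpM2r// ltW.
  lra.
- by move=> b [Tb _]; exact: diam_gt0 _ Tb.
- move=> b b' [Tb _] [Tb' _] nb; have := qf_sep fam _ _ Tb Tb' nb.
  by rewrite ler_pdivrMl//; lra.
- move=> phi [->|->] x x' /inI[x1 x2] /inI[x1' x2'].
    have -> : al + x * de - (al + x' * de) = (x - x') * de by ring.
    rewrite normrM /de -D0E; have := normr_ge0 (x - x') => h.
    have : 0 <= D0 * `|x - x'| by rewrite mulr_ge0// ltW.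
    by move=> h'; clear -fam h'; apply/andP; split; lra.
  have -> : s al + y x * de - (s al + y x' * de) = (y x - y x') * de by ring.
  rewrite normrM /de -D0E; have /andP[l1 l2] := ylip x x' x1 x2 x1' x2'.
  have p1 := ler_wpM2r (ltW D00) l1; have p2 := ler_wpM2r (ltW D00) l2.
  by clear -fam p1 p2; apply/andP; split; lra.
- move=> phi [->|->] x b /inI[x1 x2] Sb h; apply: start => //.
  + by rewrite ger0_norm//; clear -fam x1 x2 g0; lra.
  + by rewrite diam_conj.
  + by have [y1 y2 _] := ybd x x1 x2; rewrite ger0_norm// ltW.
have [x1 x2] := inI x hx; have [y1 y2 xy] := ybd x x1 x2.
exists (al + x * de), (s al + y x * de).
have E1 : al + x * de - al = x * de by ring.
have E2 : s al + y x * de - s al = y x * de by ring.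
have E3 : al + x * de - (s al + y x * de) = (1 + x - y x) * de by rewrite /de; ring.
have n1 : `|x| = x by rewrite ger0_norm//; clear -fam x1 g0; lra.
have n2 : `|y x| = y x by rewrite gtr0_norm.
have n3 : `|1 + x - y x| = 1 + x - y x.
  by rewrite ger0_norm//; clear -fam x1 y2 g1000 g0; lra.
rewrite E1 E2 E3 !normrM n1 n2 n3 /de -D0E; split.
- by rewrite ler_wpM2r// ltW.
- by rewrite ler_wpM2r// ltW.
- by rewrite mulrACA xy; ring.
- by clear -fam D00 y1 y2 x1 x2 g1000; apply/andP; split; apply: ler_wpM2r; lra.
- by move=> b Tb bD; apply: hav.
Qed.

(** The pair of [real_pair] is replaced by a rational pair (U, W), and an element of
SL2(Z) that maps W to infinity maps U to the required point. *)
Lemma prescribed_min (al t e : R) : T al -> 0 < t ->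
  10 ^+ 6 * (Dl ^+ 2 * t) <= 1 -> 0 < e ->
  exists2 m, rational m & nearly_min t e m.
Proof.
move=> Tal t0 tDl e0.
have Dl1 := qf_disc fam.
have D0gt := diam_gt0 _ Tal.
have [e1 [g [eta [z [[e10 e1e e1h th g2] [g0 gDl gD] [eta0 etaE etaD gz] [z0 zE z2 z1]]]]]]
  := scale_choice _ _ _ _ _ Dl1 t0 tDl e0 D0gt.
have [u [v]] := real_pair al t g Tal t0 tDl g0 gDl; clear tDl gDl.
have diamal : forall b, b = al -> `|b - s b| = `|al - s al| by move=> b ->.
move: diamal D0gt gD etaE etaD gz zE z2 z1.
have [D0 <-] : exists D0, D0 = `|al - s al| by eexists.
move=> diamal D00 gD etaE etaD gz zE z2 z1 /= [uA vB AB /andP[L1 L2] av].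
pose S : set R := [set b | T b /\ `|b - s b| < D0].
have ST : S `<=` T by move=> b [].
have t20 : 0 <= 2 * t by clear -fam t0; lra.
have t21 : 2 * t <= 1 by clear -fam th; lra.
have [|U [Urat Uu avU]] := rational_avoid S u (2 * t) eta ST t20 t21 eta0.
  by move=> b [Tb bD]; have [] := av b Tb bD.
have [|W [Wrat Wv avW]] := rational_avoid S v (2 * t) eta ST t20 t21 eta0.
  by move=> b [Tb bD]; have [] := av b Tb bD.
clear av.
have tU := ler_distD U u al; have tU' := ler_distD u U al.
have tW := ler_distD W v (s al); have tW' := ler_distD v W (s al).
have tL := ler_distD u U W; have tL1 := ler_distD v u W.
have tL' := ler_distD U u v; have tL1' := ler_distD W U v.
rewrite [`|u - U|]distrC in tU tL'; rewrite [`|v - W|]distrC in tW tL1.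
have Lgt : 9 / 10 * D0 - 2 * eta <= `|U - W| by clear -fam tL' tL1' L1 Uu Wv; lra.
have Lle : `|U - W| <= 11 / 10 * D0 + 2 * eta by clear -fam tL tL1 L2 Uu Wv; lra.
have /andP[lowerAB upperAB] : t * (`|U - W| * D0) <=
    2 * (`|U - al| * `|W - s al|) < (t + e1) * (`|U - W| * D0).
  apply: (@pair_perturbation R `|u - al| `|v - s al| `|u - v| _ _ _ D0 eta) => //.
  - by clear -fam tU Uu; lra.
  - by clear -fam tU' Uu; lra.
  - by clear -fam tW Wv; lra.
  - by clear -fam tW' Wv; lra.
  - by clear -fam tL tL1 Uu Wv; lra.
  - by clear -fam tL' tL1' Uu Wv; lra.
  - by clear -fam uA gD; lra.
  - by clear -fam vB gD; lra.
  - by rewrite AB mulrA g2.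
have A'z : `|U - al| <= z by clear -fam tU' uA gz Uu; lra.
have B'z : `|W - s al| <= z by clear -fam tW' vB gz Wv; lra.
clear tU tU' tW tW' tL tL1 tL' tL1' AB uA vB L1 L2 Uu Wv.
have L0 : 0 < `|U - W| by clear -fam Lgt D00 etaD; lra.
have far b a : T a -> T b -> b != a -> `|a - s a| = D0 -> D0 / 4 <= `|b - s b| ->
    2 * z <= `|b - a|.
  move=> Ta Tb nb aD bD; have := qf_sep fam _ _ Tb Ta nb; rewrite aD => h.
  have h1 : D0 / 4 <= Num.min `|b - s b| D0 by rewrite le_min bD; clear -fam D00; lra.
  have k0 : 0 < 6 * Dl by clear -fam Dl1; lra.
  by rewrite -(ler_pM2l k0); clear -fam h h1 zE; lra.
have Tsal := qf_conj fam _ Tal.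
have [a [b [c [d [det c0 WE]]]]] := rational_cusp _ _ Wrat.
have det' : d * a - (- b) * (- c) = 1 by rewrite -det; ring.
have cN0 : c%:~R != 0 :> R by rewrite intr_eq0 gt_eqF.
have den x : (- c)%:~R * x + a%:~R = c%:~R * (W - x).
  by rewrite WE rmorphN; field.
have denU : (- c)%:~R * U + a%:~R != 0.
  by rewrite den mulf_neq0// -normr_eq0 distrC gt_eqF.
have value b' : T b' -> approx s (mob d (- b) (- c) a U) (mob d (- b) (- c) a b') =
    2 * (`|U - b'| * `|W - s b'|) / (`|U - W| * `|b' - s b'|).
  move=> Tb'; rewrite approx_mob// !den /approx !normrM [`|W - U|]distrC.
  have cN : `|c%:~R : R| != 0 by rewrite normr_eq0.
  have LN : `|U - W| != 0 by rewrite gt_eqF.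
  have DN : `|b' - s b'| != 0 by rewrite gt_eqF// diam_gt0.
  by field; rewrite cN LN DN.
exists (mob d (- b) (- c) a U); first exact: rational_mob.
split.
  move=> _ /(family_preimage _ _ _ _ _ det')[b' Tb' ->].
  rewrite value// ler_pdivlMr; last by rewrite mulr_gt0// diam_gt0.
  have [->|nb] := eqVneq b' al; first by rewrite diamal.
  have Db := diam_gt0 _ Tb'.
  have Tsb := qf_conj fam _ Tb'.
  have nsb : s b' != s al.
    apply: contra_neq nb => h.
    by rewrite -(qf_conjK fam _ Tb') h (qf_conjK fam).
  apply: (@pair_excursion R _ _ _ _ D0 _ z) => //.
  - have h1 := ler_distD b' U W; have h2 := ler_distD (s b') b' W.
    by rewrite [`|s b' - W|]distrC in h2; clear -fam h1 h2; lra.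
  - have h1 := ler_distD U b' (s b'); have h2 := ler_distD W U (s b').
    by rewrite [`|b' - U|]distrC in h1; clear -fam h1 h2; lra.
  - by clear -fam Lgt etaD D00; lra.
  - by clear -fam Lle etaD D00; lra.
  - move=> bD; split; first by apply: avU.
    by rewrite -diam_conj//; apply: avW; split; rewrite ?diam_conj.
  - move=> bD; split.
      have h1 := far b' al Tal Tb' nb (diamal _ erefl) bD.
      have h2 := ler_distD U b' al; rewrite [`|b' - U|]distrC in h2.
      by clear -fam h1 h2 A'z; lra.
    have := far (s b') (s al) Tsal Tsb nsb.
    rewrite !diam_conj// => /(_ (diamal _ erefl) bD) h1.
    have h2 := ler_distD W (s b') (s al); rewrite [`|s b' - W|]distrC in h2.
    by clear -fam h1 h2 B'z; lra.
exists (mob d (- b) (- c) a al); first by have [] := qf_mob fam _ _ _ _ det' _ Tal.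
rewrite value// diamal// ltr_pdivrMr ?mulr_gt0//.
by apply: lt_le_trans upperAB _; apply: ler_wpM2r; rewrite ?lerD2l// ltW// mulr_gt0.
Qed.

Lemma family_spectrum (c : R) : T !=set0 -> 0 <= c ->
  2 * (10 ^+ 6 * (Dl ^+ 2 * c)) <= 1 ->
  exists xi, [/\ ~ rational xi, ~ T xi, forall b, T b -> c <= approx s xi b &
    forall e : R, 0 < e -> exists2 b, T b & `|b - s b| < e /\ approx s xi b < c + e].
Proof.
move=> [al Tal] c0 cDl.
have Dl1 := qf_disc fam.
have Dl2 : 1 <= Dl ^+ 2 by apply: exprn_ege1.
(* tau is the largest target that [prescribed_min] reaches; the starting point of
   the iteration is the rational number 0. *)
have [tau [tau0 tauE]] : exists tau : R, 0 < tau /\ 10 ^+ 6 * (Dl ^+ 2 * tau) = 1.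
  exists (10 ^+ 6 * Dl ^+ 2)^-1; split; first by rewrite invr_gt0; lra.
  by rewrite mulrA divff// gt_eqF//; lra.
have tau1 : 10 ^+ 6 * tau <= 1.
  have : 1 * tau <= Dl ^+ 2 * tau by apply: ler_wpM2r => //; exact: ltW.
  by move: tauE; clear -fam; lra.
have DlDl : Dl <= Dl ^+ 2 by rewrite expr2 -[leLHS]mul1r; apply: ler_wpM2r => //; lra.
have k0 : 0 < 10 ^+ 6 * Dl ^+ 2 by clear -fam Dl2; lra.
apply: (@spectrum_of_steps tau c 0) => //.
- by rewrite -(ler_pM2l k0); move: cDl tauE; clear -fam; lra.
- have : Dl * tau <= Dl ^+ 2 * tau by apply: ler_wpM2r => //; exact: ltW.
  by move: tauE; clear -fam; lra.
- by exists 0 => //; rewrite rmorph0.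
- move=> b Tb; rewrite approx_ge// leNgt; apply/negP => h.
  have := qf_rat fam _ Tb 0 1 isT; rewrite mul0r !sub0r !normrN expr1n mulr1 => h0.
  rewrite sub0r normrN in h.
  have D0 := diam_gt0 _ Tb.
  have /andP[_ DDl] := qf_diam fam _ Tb.
  have t := ler_distD b 0 (s b); rewrite !sub0r !normrN in t.
  have tD : tau * `|b - s b| <= 1 * `|b - s b|.
    by apply: ler_wpM2r; [exact: ltW|move: tau1; clear -fam; lra].
  have h1 : `|b| * `|s b| <= `|b| * (2 * `|b - s b|).
    by apply: ler_wpM2l => //; clear -fam t tD h D0; lra.
  have h2 : Dl * (`|b| * `|s b|) <= Dl * (`|b| * (2 * `|b - s b|)).
    by apply: ler_wpM2l => //; clear -fam Dl1; lra.
  have h3 : Dl * `|b - s b| * (2 * `|b|) < Dl * `|b - s b| * (tau * `|b - s b|).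
    by rewrite ltr_pM2l// mulr_gt0//; clear -fam Dl1; lra.
  have h4 : Dl * tau * `|b - s b| * `|b - s b| <= Dl * tau * `|b - s b| * Dl.
    by apply: ler_wpM2l => //; rewrite !mulr_ge0 ?(ltW tau0) ?(ltW D0)//; clear -fam Dl1; lra.
  have h5 : Dl ^+ 2 * tau * `|b - s b| <= 1 * `|b - s b|.
    by apply: ler_wpM2r; [exact: ltW|move: tauE; clear -fam; lra].
  by clear -fam h0 h2 h3 h4 h5; lra.
- apply: (@cusp_step tau) => //; first by move: tau1; clear -fam; lra.
  move=> t e t0 ttau e0; apply: (@prescribed_min al) => //.
  apply: (@le_trans _ _ (10 ^+ 6 * (Dl ^+ 2 * tau))); last by rewrite tauE.
  apply: ler_wpM2l; first by clear -fam; lra.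
  by apply: ler_wpM2l => //; exact: sqr_ge0.
Qed.

End Family.

(** * Integral quadratic forms and the orbits of a quadratic number *)

Definition kills (R : realType) (a b c : int) (x : R) : Prop :=
  a%:~R * x ^+ 2 + b%:~R * x + c%:~R = 0.

Arguments kills {R}.

Lemma irrational_ratr (R : realType) (x : R) (q0 q1 : rat) : irrational x ->
  ratr q1 * x + ratr q0 = 0 -> q1 = 0 /\ q0 = 0.
Proof.
move=> xirr h; have [q10|q10] := eqVneq q1 0.
  by move: h; rewrite q10 rmorph0 mul0r add0r => /eqP; rewrite fmorph_eq0 => /eqP.
exfalso; apply: xirr; exists (- q0 / q1) => //.
have q1n : ratr q1 != 0 :> R by rewrite fmorph_eq0.
rewrite fmorph_div/= rmorphN/=; have -> : ratr q0 = - (ratr q1 * x) :> R by lra.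
by field.
Qed.

Lemma kills_lead (R : realType) (a b c : int) (x : R) : irrational x ->
  kills a b c x -> b ^+ 2 - 4 * a * c != 0 -> a != 0.
Proof.
move=> xirr h; apply: contraNneq => a0; move: h; rewrite /kills a0 mul0r add0r => h.
have [|b0 _] := irrational_ratr R x c%:~R b%:~R xirr; first by rewrite !ratr_int.
by move: b0 => /eqP; rewrite intr_eq0 => /eqP ->; rewrite mulr0 mul0r expr0n.
Qed.

(** The remainder of any annihilating polynomial has degree at most 1, hence is zero
because [x] is irrational. *)
Lemma minpoly_of_kills (R : realType) (a b c : int) (x : R) : irrational x -> a != 0 ->
  kills a b c x ->
  let p : {poly rat} := 'X^2 + (b%:~R / a%:~R) *: 'X + (c%:~R / a%:~R)%:P in
  is_minpoly x p /\
  forall y : R, root (map_poly ratr p) y <-> kills a b c y.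
Proof.
move=> xirr a0 ax p.
have aR : a%:~R != 0 :> R by rewrite intr_eq0.
have rootp (y : R) : root (map_poly ratr p) y <-> kills a b c y.
  have E : (map_poly ratr p).[y] * a%:~R = a%:~R * y ^+ 2 + b%:~R * y + c%:~R.
    rewrite /p !rmorphD/= map_polyXn map_polyZ map_polyX map_polyC/= !hornerE.
    by rewrite !fmorph_div/= !ratr_int; field.
  rewrite /kills -E /root; split => [/eqP->|/eqP]; first by rewrite mul0r.
  by rewrite mulf_eq0 (negPf aR) orbF.
have sz : (size (((b%:~R / a%:~R) *: 'X + (c%:~R / a%:~R)%:P)%R : {poly rat}) < 3)%N.
  rewrite (leq_ltn_trans (size_polyD _ _))// gtn_max.
  rewrite (leq_ltn_trans (size_scale_leq _ _)) ?size_polyX//.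
  by rewrite (leq_ltn_trans (size_polyC_leq1 _)).
have pm : p \is monic.
  by rewrite monicE /p -addrA lead_coefDl ?size_polyXn// lead_coefXn.
have szp : size p = 3%N by rewrite /p -addrA size_polyDl ?size_polyXn.
split=> //; split => //; first exact/rootp.
move=> q qx; rewrite /dvdp; apply/eqP.
have p0 : p != 0 by rewrite monic_neq0.
set r := q %% p.
have szr : (size r <= 2)%N by have := ltn_modp q p; rewrite p0 szp ltnS.
have rx : (map_poly ratr r).[x] = 0.
  move: qx; rewrite {1}(divp_eq q p) rmorphD rmorphM /root !hornerE/=.
  have /rootp/eqP -> := ax; by rewrite mulr0 add0r => /eqP.
have szr' : (size (map_poly (ratr : rat -> R) r) <= 2)%N by rewrite size_map_poly.
move: rx; rewrite (horner_coef_wide _ szr') !big_ord_recl big_ord0/= !coef_map/=.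
rewrite expr0 mulr1 expr1 addr0 addrC => /(irrational_ratr _ _ _ _ xirr)[r1 r0].
apply/polyP => -[|[|i]]; rewrite coef0//.
by apply: nth_default; rewrite (leq_trans szr).
Qed.

Lemma is_minpoly_unique (R : realType) (x : R) (p q : {poly rat}) :
  is_minpoly x p -> is_minpoly x q -> p = q.
Proof.
move=> [pm px pd] [qm qx qd]; apply/eqP; rewrite -eqp_monic// /eqp.
by rewrite pd// qd.
Qed.

Lemma galois_conjP (R : realType) (a b c : int) (x : R) : irrational x -> a != 0 ->
  kills a b c x ->
  [/\ galois_conj x != x, irrational (galois_conj x), kills a b c (galois_conj x),
      b%:~R = - (a%:~R * (x + galois_conj x)) & c%:~R = a%:~R * (x * galois_conj x)].
Proof.
move=> xirr a0 ax.
have aR : a%:~R != 0 :> R by rewrite intr_eq0.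
have [minp rootp] := minpoly_of_kills R a b c x xirr a0 ax.
pose z := - b%:~R / a%:~R - x.
have bE : b%:~R = - (a%:~R * (x + z)) by rewrite /z; field.
have cE : c%:~R = a%:~R * (x * z).
  by move: ax; rewrite /kills bE => h; apply/eqP; rewrite -subr_eq0 -h; apply/eqP; ring.
have zx : z != x.
  apply/eqP => E; have [|/eqP] := irrational_ratr R x b%:~R (2 * a%:~R) xirr.
    by rewrite rmorphM/= !ratr_int ratr_nat bE E; ring.
  by rewrite mulf_eq0 intr_eq0 (negPf a0).
have zk : kills a b c z by rewrite /kills bE cE; ring.
have zirr : irrational z.
  move=> [q _ qz]; apply: xirr; exists (- b%:~R / a%:~R - q) => //.
  by rewrite rmorphB/= fmorph_div/= rmorphN/= !ratr_int qz /z; ring.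
suff -> : galois_conj x = z by [].
rewrite /galois_conj; case: xgetP => [y _ [yx [p pmin py]]|/(_ z)]; last first.
  case; split => //.
  by exists ('X^2 + (b%:~R / a%:~R) *: 'X + (c%:~R / a%:~R)%:P) => //; apply/rootp.
move: py; rewrite (is_minpoly_unique _ _ _ _ pmin minp) => /rootp.
rewrite /kills bE cE => h.
have : a%:~R * (y - x) * (y - z) = 0 by rewrite -h; ring.
move/eqP; rewrite !mulf_eq0 (negPf aR) !subr_eq0 (negPf yx)/= => /eqP.
by [].
Qed.

Lemma galois_conj_root (R : realType) (a b c : int) (x z : R) : irrational x -> a != 0 ->
  kills a b c x -> kills a b c z -> z != x -> galois_conj x = z.
Proof.
move=> xirr a0 ax az zx; have [_ _ _ bE cE] := galois_conjP R a b c x xirr a0 ax.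
have aR : a%:~R != 0 :> R by rewrite intr_eq0.
move: az; rewrite /kills bE cE => h.
have : a%:~R * (z - x) * (z - galois_conj x) = 0 by rewrite -h; ring.
by move/eqP; rewrite !mulf_eq0 (negPf aR) !subr_eq0 (negPf zx)/= => /eqP.
Qed.

Lemma galois_conjK (R : realType) (a b c : int) (x : R) : irrational x -> a != 0 ->
  kills a b c x -> galois_conj (galois_conj x) = x.
Proof.
move=> xirr a0 ax; have [n zi zk _ _] := galois_conjP R a b c x xirr a0 ax.
by apply: (galois_conj_root R a b c); rewrite // eq_sym.
Qed.

(** The form need not be primitive, so the discriminant is not determined by [x]. *)
Definition disc_form (R : realType) (Dl : int) (x : R) : Prop :=
  exists a b c : int, [/\ a != 0, b ^+ 2 - 4 * a * c = Dl & kills a b c x].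

Arguments disc_form {R}.

Lemma disc_gt0 (R : realType) (Dl : int) (x : R) : irrational x -> disc_form Dl x -> 0 < Dl.
Proof.
move=> xirr [a [b [c [a0 <- ax]]]].
have [zx _ _ bE cE] := galois_conjP R a b c x xirr a0 ax.
have aR : a%:~R != 0 :> R by rewrite intr_eq0.
rewrite -(ltr0z R) rmorphB/= rmorphXn/= !rmorphM/= bE cE.
have -> : (- (a%:~R * (x + galois_conj x))) ^+ 2 -
   4%:~R * a%:~R * (a%:~R * (x * galois_conj x)) = (a%:~R * (galois_conj x - x)) ^+ 2 :> R by ring.
by rewrite lt_neqAle sqr_ge0 andbT eq_sym sqrf_eq0 mulf_eq0 (negPf aR) subr_eq0.
Qed.

Lemma irrational_mob (R : realType) (p q r t : int) (x : R) : p * t - q * r = 1 ->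
  irrational x -> irrational (mob p q r t x).
Proof.
move=> h xirr xr; apply: (xirr).
rewrite -(mob_invl R p q r t x h); first exact: rational_mob.
exact: irrational_den h.
Qed.

Lemma kills_mob (R : realType) (p q r t a b c : int) (x : R) : p * t - q * r = 1 ->
  r%:~R * x + t%:~R != 0 -> kills a b c x ->
  kills (a * t ^+ 2 - b * r * t + c * r ^+ 2)
   (- 2 * a * q * t + b * (p * t + q * r) - 2 * c * p * r)
   (a * q ^+ 2 - b * p * q + c * p ^+ 2) (mob p q r t x).
Proof.
move=> h hx; have hd := @det_real R _ _ _ _ h; rewrite /kills /mob => ax.
rewrite !(rmorphD, rmorphB, rmorphN, rmorphM, rmorphXn)/=.
have E : (p%:~R * t%:~R - q%:~R * r%:~R) ^+ 2 * (a%:~R * x ^+ 2 + b%:~R * x + c%:~R)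
   / (r%:~R * x + t%:~R) ^+ 2 = 0 :> R by rewrite ax mulr0 mul0r.
by rewrite -[RHS]E; field.
Qed.

(** The substitution by a matrix of determinant 1 preserves the discriminant, and the
image of the conjugate is a second root of the new form. *)
Lemma disc_form_mob (R : realType) (p q r t : int) (Dl : int) (x : R) : p * t - q * r = 1 ->
  irrational x -> disc_form Dl x -> disc_form Dl (mob p q r t x) /\
   galois_conj (mob p q r t x) = mob p q r t (galois_conj x).
Proof.
move=> h xirr dx; have Dl0 := disc_gt0 R Dl x xirr dx.
case: dx => a [b [c [a0 DE ax]]].
have [zx zirr az _ _] := galois_conjP R a b c x xirr a0 ax.
have xd := irrational_den R x p q r t xirr h.
have zd := irrational_den R _ p q r t zirr h.
have gx := kills_mob R p q r t a b c x h xd ax.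
have gz := kills_mob R p q r t a b c _ h zd az.
set a' := (_ + c * r ^+ 2) in gx gz; set b' := (_ - 2 * c * p * r) in gx gz.
set c' := (_ + c * p ^+ 2) in gx gz.
have DE' : b' ^+ 2 - 4 * a' * c' = Dl.
  transitivity ((p * t - q * r) ^+ 2 * (b ^+ 2 - 4 * a * c)).
    by rewrite /a' /b' /c'; ring.
  by rewrite h expr1n mul1r.
have gxirr := irrational_mob R p q r t x h xirr.
have a'0 : a' != 0 by apply: kills_lead gxirr gx _; rewrite DE' gt_eqF.
split; first by exists a', b', c'.
apply: (galois_conj_root R a' b' c') => //.
rewrite -subr_eq0 mob_sub// mulf_eq0 invr_eq0 mulf_eq0 !negb_or subr_eq0 zx/=.
by rewrite zd xd.
Qed.

Lemma det2 (g : 'M[int]_2) : \det g = g 0 0 * g 1 1 - g 0 1 * g 1 0.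
Proof.
rewrite (expand_det_row _ ord0) !big_ord_recl big_ord0 /cofactor !det_mx11 !mxE /=.
have e1 : lift ord0 ord0 = 1 :> 'I_2 by apply: val_inj.
have e2 : lift (1 : 'I_2) ord0 = 0 :> 'I_2 by apply: val_inj.
have e3 : ord0 = 0 :> 'I_2 by apply: val_inj.
by rewrite !e1 ?e2 ?e3 /bump /= ?expr0 ?expr1; ring.
Qed.

Lemma mem_PSL2Z_orbit (R : realType) (x : R) (p q r t : int) : p * t - q * r = 1 ->
  PSL2Z_orbit x (mob p q r t x).
Proof.
move=> h; exists (\matrix_(i < 2, j < 2) if i == 0 then (if j == 0 then p else q)
                             else (if j == 0 then r else t)).
  by rewrite det2 !mxE /= h.
by rewrite /mobius !mxE.
Qed.

Lemma orbit_mob (R : realType) (x y : R) (p q r t : int) : irrational x ->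
  p * t - q * r = 1 -> PSL2Z_orbit x y -> PSL2Z_orbit x (mob p q r t y).
Proof.
move=> xirr h [g]; rewrite det2 => dg ->.
have h2 : (p * g 0 0 + q * g 1 0) * (r * g 0 1 + t * g 1 1) -
    (p * g 0 1 + q * g 1 1) * (r * g 0 0 + t * g 1 0) = 1.
  transitivity ((p * t - q * r) * (g 0 0 * g 1 1 - g 0 1 * g 1 0)); first by ring.
  by rewrite h dg.
rewrite (_ : mob _ _ _ _ _ = mob (p * g 0 0 + q * g 1 0) (p * g 0 1 + q * g 1 1)
   (r * g 0 0 + t * g 1 0) (r * g 0 1 + t * g 1 1) x); first exact: mem_PSL2Z_orbit.
have d1 := irrational_den R x _ _ _ _ xirr dg.
have d2 := irrational_den R x _ _ _ _ xirr h2.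
rewrite /mob /mobius !(rmorphD, rmorphM)/= in d2 *.
field.
by rewrite d1 d2.
Qed.

Lemma int_norm_ge1 (R : realType) (n : int) : n != 0 -> 1 <= `|n%:~R : R|.
Proof. by move=> n0; rewrite -intr_norm -[1]/(1%:~R) ler_int -gtz0_ge1 normr_gt0. Qed.

(** The roots of a form (a, b, c) differ by the square root of the discriminant
divided by a. *)
Lemma lead_diam (R : realType) (Dl a b c : int) (x : R) : irrational x -> a != 0 ->
  b ^+ 2 - 4 * a * c = Dl -> kills a b c x ->
  (`|a%:~R| * `|x - galois_conj x|) ^+ 2 = Dl%:~R /\
  `|a%:~R| * `|x - galois_conj x| <= Dl%:~R.
Proof.
move=> xirr a0 DE ax.
have Dl0 := disc_gt0 R Dl x xirr (ex_intro _ a (ex_intro _ b (ex_intro _ c (And3 a0 DE ax)))).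
have [_ _ _ bE cE] := galois_conjP R a b c x xirr a0 ax.
have sq : (`|a%:~R| * `|x - galois_conj x|) ^+ 2 = Dl%:~R.
  rewrite -normrM real_normK ?num_real// -DE rmorphB/= rmorphXn/= !rmorphM/= bE cE; ring.
split=> //; have Dl1 : 1 <= Dl%:~R :> R by rewrite -[1]/(1%:~R) ler_int -gtz0_ge1.
rewrite -ler_sqr ?nnegrE ?mulr_ge0//; last by lra.
by rewrite sq expr2 -[leLHS]mul1r; apply: ler_wpM2r; lra.
Qed.

(** With the forms (a, b, c) and (a', b', c') the identity [key] below expresses
2 a a' (x - y)(s - s') as the sum of the invariant 2 a c' + 2 a' c - b b' and of
the discriminant up to sign. It is thus a nonzero integer, which bounds
|x - y| |s - s'| from below by D(x) D(y) / (2 Dl); moreover |s - s'| is at most 3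
times the larger diameter when x and y are close. *)
Lemma disc_form_sep (R : realType) (Dl : int) (x y : R) :
  irrational x -> irrational y -> disc_form Dl x -> disc_form Dl y ->
  x != y -> galois_conj x != galois_conj y ->
  Num.min `|x - galois_conj x| `|y - galois_conj y| <= 6 * Dl%:~R * `|x - y|.
Proof.
move=> xirr yirr dx dy xy sxy.
have Dl0 := disc_gt0 R Dl x xirr dx.
have Dl1 : 1 <= Dl%:~R :> R by rewrite -[1]/(1%:~R) ler_int -gtz0_ge1.
case: dx => a [b [c [a0 DE ax]]]; case: dy => a' [b' [c' [a'0 DE' ay]]].
have [sq1 _] := lead_diam R Dl a b c x xirr a0 DE ax.
have [sq2 _] := lead_diam R Dl a' b' c' y yirr a'0 DE' ay.
have [n1 _ _ bE cE] := galois_conjP R a b c x xirr a0 ax.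
have [n2 _ _ bE' cE'] := galois_conjP R a' b' c' y yirr a'0 ay.
have aR : a%:~R != 0 :> R by rewrite intr_eq0.
have aR' : a'%:~R != 0 :> R by rewrite intr_eq0.
move: n1 n2 bE cE bE' cE' sxy sq1 sq2.
move: (galois_conj x) (galois_conj y) => s s' n1 n2 bE cE bE' cE' sxy sq1 sq2.
have dx0 : 0 < `|x - s| by rewrite normr_gt0 subr_eq0 eq_sym.
have dy0 : 0 < `|y - s'| by rewrite normr_gt0 subr_eq0 eq_sym.
pose J : int := 2 * a * c' + 2 * a' * c - b * b'.
have key : 2 * a%:~R * a'%:~R * ((x - y) * (s - s')) =
   J%:~R + (a%:~R * (x - s)) * (a'%:~R * (y - s')) :> R.
  rewrite /J rmorphB/= rmorphD/= !rmorphM/= bE cE bE' cE'; ring.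
clearbody J.
have prodE : (`|a%:~R| * `|x - s|) * (`|a'%:~R| * `|y - s'|) = Dl%:~R :> R.
  apply/eqP; rewrite -(@eqrXn2 _ 2) ?mulr_ge0//; last by lra.
  by rewrite exprMn sq1 sq2 expr2.
have [n nE] : exists n : int, 2 * a%:~R * a'%:~R * ((x - y) * (s - s')) = n%:~R :> R.
  have : `|(a%:~R * (x - s)) * (a'%:~R * (y - s'))| = Dl%:~R by rewrite !normrM prodE.
  move=> h; have [p|p] := leP 0 ((a%:~R * (x - s)) * (a'%:~R * (y - s'))).
    by exists (J + Dl); rewrite key intrD -h ger0_norm.
  by exists (J - Dl); rewrite key rmorphB/= -h ltr0_norm// opprK.
have n0 : n != 0.
  by rewrite -(intr_eq0 R) -nE !mulf_eq0 !negb_or pnatr_eq0 aR aR' !subr_eq0 xy sxy.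
have := int_norm_ge1 R n n0; rewrite -nE !normrM normr_nat => h1.
have h2 : `|x - s| * `|y - s'| <= 2 * Dl%:~R * (`|x - y| * `|s - s'|).
  have : `|x - s| * `|y - s'| * 1 <= `|x - s| * `|y - s'| *
     (2 * `|a%:~R| * `|a'%:~R| * (`|x - y| * `|s - s'|)).
    by apply: ler_wpM2l => //; rewrite mulr_ge0.
  by rewrite -prodE; lra.
have h3 : `|s - s'| <= `|x - s| + `|x - y| + `|y - s'|.
  have := ler_distD x s s'; have := ler_distD y x s'; rewrite [`|s - x|]distrC; lra.
move: dx0 dy0 h2 h3; clear -Dl1.
have := normr_ge0 (x - y); have := normr_ge0 (s - s').
move: `|x - s| `|y - s'| `|x - y| `|s - s'| (Dl%:~R : R) Dl1 => d1 d2 d e D D1.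
move=> e0 d0 d10 d20 h2 h3.
rewrite leNgt lt_min; apply/negP => /andP[l1 l2].
have dD : d * 1 <= d * D by apply: ler_wpM2l.
have dD0 : 0 <= D * d by rewrite mulr_ge0//; lra.
have [d12|d12] := leP d1 d2.
  have h4 : D * d * e <= D * d * (3 * d2) by apply: ler_wpM2l => //; lra.
  have : 6 * D * d * d2 < d1 * d2 by rewrite ltr_pM2r.
  lra.
have h4 : D * d * e <= D * d * (3 * d1) by apply: ler_wpM2l => //; lra.
have : 6 * D * d * d1 < d2 * d1 by rewrite ltr_pM2r.
lra.
Qed.

(** The value of the form at (p, q) is a nonzero integer. *)
Lemma disc_form_rat (R : realType) (Dl : int) (x : R) (p q : int) :
  irrational x -> disc_form Dl x -> q != 0 ->
  `|x - galois_conj x| <= Dl%:~R * q%:~R ^+ 2 *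
       (`|p%:~R / q%:~R - x| * `|p%:~R / q%:~R - galois_conj x|).
Proof.
move=> xirr [a [b [c [a0 DE ax]]]] q0.
have [_ le] := lead_diam R Dl a b c x xirr a0 DE ax.
have [n1 zirr _ bE cE] := galois_conjP R a b c x xirr a0 ax.
have aR : a%:~R != 0 :> R by rewrite intr_eq0.
have qR : q%:~R != 0 :> R by rewrite intr_eq0.
pose n : int := a * p ^+ 2 + b * p * q + c * q ^+ 2.
have nE : n%:~R = a%:~R * q%:~R ^+ 2 * ((p%:~R / q%:~R - x) * (p%:~R / q%:~R - galois_conj x)) :> R.
  rewrite /n !(rmorphD, rmorphM, rmorphXn)/= bE cE; field => //.
have prat : rational (p%:~R / q%:~R : R).
  by exists (p%:~R / q%:~R) => //; rewrite fmorph_div/= !ratr_int.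
have n0 : n != 0.
  rewrite -(intr_eq0 R) nE !mulf_neq0// ?expf_neq0// subr_eq0; apply/eqP => E.
    by apply: xirr; rewrite -E.
  by apply: zirr; rewrite -E.
have := int_norm_ge1 R n n0; rewrite nE 2!normrM normrX real_normK ?num_real// normrM.
move: le; have := normr_ge0 (x - galois_conj x).
move: `|x - galois_conj x| `|a%:~R : R| => d A d0 le h.
have := mulr_ge0 (normr_ge0 (p%:~R / q%:~R - x)) (normr_ge0 (p%:~R / q%:~R - galois_conj x)).
have := sqr_ge0 (q%:~R : R).
move: h.
move: (q%:~R ^+ 2) (`|p%:~R / q%:~R - x| * `|p%:~R / q%:~R - galois_conj x|) => Q P h Q0 P0.
have h1 : d * 1 <= d * (A * Q * P) by apply: ler_wpM2l.
have h2 : (A * d) * (Q * P) <= Dl%:~R * (Q * P) by apply: ler_wpM2r => //; rewrite mulr_ge0.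
by clear -h1 h2; lra.
Qed.

Lemma mobE (R : realType) (g : 'M[int]_2) (x : R) :
  mobius g x = mob (g 0 0) (g 0 1) (g 1 0) (g 1 1) x.
Proof. by []. Qed.

Lemma PSL2Z_orbit_disc_form (R : realType) (Dl : int) (x y : R) : irrational x -> disc_form Dl x ->
  PSL2Z_orbit x y -> [/\ irrational y, disc_form Dl y &
   PSL2Z_orbit (galois_conj x) (galois_conj y)].
Proof.
move=> xirr dx [g]; rewrite det2 => dg ->; rewrite mobE.
have [dy cE] := disc_form_mob R _ _ _ _ Dl x dg xirr dx.
split => //; first exact: irrational_mob.
by rewrite cE; apply: mem_PSL2Z_orbit.
Qed.

Lemma Theta_family (R : realType) (Dl : int) (alpha : R) :
  irrational alpha -> disc_form Dl alpha ->
  quadratic_family (Theta alpha) (@galois_conj R) Dl%:~R.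
Proof.
move=> airr da.
have [sirr dsa saK] : [/\ irrational (galois_conj alpha), disc_form Dl (galois_conj alpha) &
   galois_conj (galois_conj alpha) = alpha].
  case: da => a [b [c [a0 DE ax]]]; have [_ zirr az _ _] := galois_conjP R a b c alpha airr a0 ax.
  by split => //; [exists a, b, c|apply: galois_conjK airr a0 ax].
have facts y : Theta alpha y -> [/\ irrational y, disc_form Dl y & Theta alpha (galois_conj y)].
  case=> [/(PSL2Z_orbit_disc_form R Dl _ _ airr da)|
           /(PSL2Z_orbit_disc_form R Dl _ _ sirr dsa)] [h1 h2 h3]; split => //.
    by right.
  by left; rewrite saK in h3.
have conjK y : Theta alpha y -> galois_conj (galois_conj y) = y.
  move=> /facts[yirr [a [b [c [a0 _ ay]]]] _]; exact: galois_conjK yirr a0 ay.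
split=> //.
- by rewrite -[1]/(1%:~R) ler_int -gtz0_ge1; apply: disc_gt0 airr da.
- by move=> b /facts[].
- by move=> b /facts[].
- move=> p q r t h b Tb; have [birr db _] := facts b Tb; split; last first.
    by have [] := disc_form_mob R p q r t Dl b h birr db.
  by case: Tb => Tb; [left|right]; apply: orbit_mob.
- move=> b /facts[birr [a [b' [c' [a0 DE ab]]]] _].
  have [_ le] := lead_diam R Dl _ _ _ _ birr a0 DE ab.
  have [n _ _ _ _] := galois_conjP R _ _ _ _ birr a0 ab.
  rewrite normr_gt0 subr_eq0 eq_sym n /=; apply: le_trans le.
  by rewrite -[leLHS]mul1r; apply: ler_wpM2r => //; apply: int_norm_ge1.
- move=> b b' Tb Tb' nb; have [birr db _] := facts b Tb; have [birr' db' _] := facts b' Tb'.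
  apply: disc_form_sep => //; apply: contra_neq nb => h.
  by rewrite -(conjK b)// h conjK.
- by move=> b /facts[birr db _] p q q0; apply: disc_form_rat.
Qed.

(** * Periods of continued fractions and the discriminant *)

Lemma disc_form_real_quadratic (R : realType) (x : R) : real_quadratic x ->
  exists Dl : int, disc_form Dl x.
Proof.
move=> [xirr [p [pm px _] szp]].
pose d1 := denq p`_1; pose d0 := denq p`_0.
have p2 : p`_2 = 1 by move: pm; rewrite monicE lead_coefE szp => /eqP.
have nz (q : rat) : (denq q)%:~R != 0 :> R by rewrite intr_eq0 denq_neq0.
pose a := d1 * d0; pose b := numq p`_1 * d0; pose c := numq p`_0 * d1.
exists (b ^+ 2 - 4 * a * c), a, b, c; split => //.
  by rewrite /a mulf_neq0// denq_neq0.
have sz : (size (map_poly (ratr : rat -> R) p) <= 3)%N by rewrite size_map_poly szp.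
move/eqP: px; rewrite (horner_coef_wide _ sz) !big_ord_recl big_ord0/= !coef_map/=.
rewrite /bump/= p2 rmorph1 expr0 mulr1 expr1 addr0 mul1r => h.
have E (q : rat) : ratr q * (denq q)%:~R = (numq q)%:~R :> R.
  by rewrite -{1}(divq_num_den q) fmorph_div/= !ratr_int; field; exact: nz.
rewrite /kills /a /b /c !rmorphM/= -!E -/d1 -/d0.
transitivity (d1%:~R * d0%:~R * (ratr p`_0 + (ratr p`_1 * x + x ^+ 2)) : R); first by ring.
by rewrite h mulr0.
Qed.

(** The form of the k-th complete quotient is the given one after the substitution
of the convergent matrix. Its outer coefficients are values of the given form at
convergents, which are bounded since the errors are at most 1 / q; the middle
one is then bounded by the discriminant. *)
Lemma complete_quotient_form (R : realType) (x : R) (a b c : int) (Dl : int) :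
  irrational x -> a != 0 -> b ^+ 2 - 4 * a * c = Dl -> kills a b c x ->
  exists M : nat, forall k, exists f : int * int * int,
    [/\ [/\ f.1.1 != 0, f.1.2 ^+ 2 - 4 * f.1.1 * f.2 = Dl &
         kills f.1.1 f.1.2 f.2 (complete_quotient x k.+1)] &
        [/\ `|f.1.1| <= M%:Z, `|f.1.2| <= M%:Z & `|f.2| <= M%:Z]].
Proof.
move=> xirr a0 DE ax.
have Dl0 := disc_gt0 R Dl x xirr (ex_intro _ a (ex_intro _ b (ex_intro _ c (And3 a0 DE ax)))).
have [_ _ _ bE cE] := galois_conjP R a b c x xirr a0 ax.
set z := galois_conj x in bE cE.
have [K hK] : exists K : nat, `|a%:~R : R| * (1 + `|x - z|) < K%:R.
  exists (Num.bound (`|a%:~R : R| * (1 + `|x - z|))); apply: archi_boundP.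
  by rewrite mulr_ge0// addr_ge0.
exists (K + absz Dl + 4 * K * K)%N => k.
have [p [q [p' [q' [[dt q'0 q'q q1 _] hx _]]]]] := convergents R x k xirr.
have y1 := complete_quotient_gt1 R x k xirr.
have yirr := irrational_complete_quotient R x k.+1 xirr.
have E := hx x xirr (fun j _ => erefl); cbv zeta in E.
have [e1 e2] := convergent_errors R x _ _ _ _ _ dt q'0 q1 y1 E.
move: (complete_quotient x k.+1) y1 yirr E => y y1 yirr E.
have bound (u v : int) : 0 <= v -> v <= q -> `|v%:~R * x - u%:~R| * q%:~R <= 1 ->
    `|a * u ^+ 2 + b * u * v + c * v ^+ 2| <= K%:Z.
  move=> v0 vq e; rewrite -(ler_int R) intr_norm.
  have -> : (a * u ^+ 2 + b * u * v + c * v ^+ 2)%:~R =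
     a%:~R * ((v%:~R * x - u%:~R) * ((v%:~R * x - u%:~R) - v%:~R * (x - z))) :> R.
    by rewrite !(intrD, intrM) -?rmorphXn bE cE; ring.
  rewrite !normrM; apply: le_trans (ltW hK); apply: ler_wpM2l => //.
  have v0R : 0 <= v%:~R :> R by rewrite ler0z.
  have vqR : v%:~R <= q%:~R :> R by rewrite ler_int.
  have q1R : 1 <= q%:~R :> R by rewrite -[1]/(1%:~R) ler_int.
  move: e; have := normr_ge0 (v%:~R * x - u%:~R); set t := v%:~R * x - u%:~R => t0 e.
  have t1 : `|t| * 1 <= `|t| * q%:~R by apply: ler_wpM2l.
  have tri : `|t - v%:~R * (x - z)| <= `|t| + v%:~R * `|x - z|.
    by apply: le_trans (ler_normB _ _) _; rewrite normrM (ger0_norm v0R).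
  apply: le_trans (ler_wpM2l t0 tri) _.
  have h1 : `|t| * `|t| <= 1 * 1 by apply: ler_pM; lra.
  have h2 : `|t| * v%:~R * `|x - z| <= `|t| * q%:~R * `|x - z|.
    by apply: ler_wpM2r => //; apply: ler_wpM2l.
  have h3 : `|t| * q%:~R * `|x - z| <= 1 * `|x - z| by apply: ler_wpM2r.
  lra.
pose A := a * p ^+ 2 + b * p * q + c * q ^+ 2.
pose Bk := 2 * a * p * p' + b * (p * q' + p' * q) + 2 * c * q * q'.
pose C := a * p' ^+ 2 + b * p' * q' + c * q' ^+ 2.
have DE' : Bk ^+ 2 - 4 * A * C = Dl.
  transitivity ((p * q' - p' * q) ^+ 2 * (b ^+ 2 - 4 * a * c)).
    by rewrite /Bk /A /C; ring.
  by rewrite dt mul1r.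
have ky : kills A Bk C y.
  have d0 : q%:~R * y + q'%:~R != 0.
    rewrite gt_eqF//; have : 0 <= q'%:~R :> R by rewrite ler0z.
    have : 0 < q%:~R * y by apply: mulr_gt0; [rewrite ltr0z; lia|lra].
    lra.
  rewrite /kills /A /Bk /C !(intrD, intrM) -?rmorphXn/=.
  transitivity (a%:~R * (p%:~R * y + p'%:~R) ^+ 2 + b%:~R * (p%:~R * y + p'%:~R) *
    (q%:~R * y + q'%:~R) + c%:~R * (q%:~R * y + q'%:~R) ^+ 2 : R); first by ring.
  rewrite -E; transitivity ((a%:~R * x ^+ 2 + b%:~R * x + c%:~R) * (q%:~R * y + q'%:~R) ^+ 2 : R).
    by ring.
  by rewrite ax mul0r.
have A0 : A != 0 by apply: kills_lead yirr ky _; rewrite DE' gt_eqF.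
have hA : `|A| <= K%:Z by apply: bound => //; lia.
have hC : `|C| <= K%:Z by apply: bound => //; lia.
exists (A, Bk, C); split=> //=.
have hB : Bk ^+ 2 <= Dl + 4 * (K%:Z * K%:Z).
  have : A * C <= K%:Z * K%:Z.
    by apply: le_trans (ler_norm _) _; rewrite normrM; apply: ler_pM.
  by move: DE'; clear; lia.
have KM : K%:Z <= (K + absz Dl + 4 * K * K)%N%:Z by rewrite lez_nat -addnA leq_addr.
split; [exact: le_trans hA KM| |exact: le_trans hC KM].
have BB : `|Bk| <= Bk ^+ 2.
  rewrite -(real_normK (num_real Bk)); move: `|Bk|%R (normr_ge0 Bk); clear => u u0.
  by rewrite expr2; nia.
apply: le_trans BB (le_trans hB _); move: Dl0; clear => Dl0.
rewrite !PoszD !PoszM; lia.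
Qed.

(** Pigeonhole on the forms of bounded coefficients, with one bit to tell the two roots
of a form apart. *)
Lemma lagrange_repeat (R : realType) (x : R) (Dl : int) : irrational x -> disc_form Dl x ->
  exists i j : nat, (i < j)%N /\ complete_quotient x i.+1 = complete_quotient x j.+1.
Proof.
move=> xirr [a [b [c [a0 DE ax]]]].
have [M hM] := complete_quotient_form R x a b c Dl xirr a0 DE ax.
have [f hf] := choice hM.
(* The shift by M makes the coefficients nonnegative. *)
pose code (n : int) : 'I_(2 * M).+1 := inord (absz (n + M%:Z)).
have codeI n n' : `|n| <= M%:Z -> `|n'| <= M%:Z -> code n = code n' -> n = n'.
  move=> h h' /(congr1 val); rewrite /= !inordK; lia.
pose y k := complete_quotient x k.+1.
pose g (k : nat) := (code (f k).1.1, code (f k).1.2, code (f k).2,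
   0 <= (2 * (f k).1.1)%:~R * y k + ((f k).1.2)%:~R).
pose T := ('I_(2 * M).+1 * 'I_(2 * M).+1 * 'I_(2 * M).+1 * bool)%type.
pose gn (i : 'I_(#|{: T}|.+1)) : T := g i.
have : ~~ injectiveb gn.
  apply/negP => /injectiveP/leq_card; rewrite card_ord.
  by rewrite ltnn.
move=> /injectivePn[i [j ij gij]].
have eqy k l : g k = g l -> y k = y l.
  move=> [/codeI e1 /codeI e2 /codeI e3 e4].
  have [[n1 d1 k1] [b1 b2 b3]] := hf k; have [[n2 d2 k2] [b4 b5 b6]] := hf l.
  move: e4 k2 d2 n2; rewrite -e1// -e2// -e3// => e4 k2 d2 n2.
  move: e4 k1 k2 d1 n1; rewrite -/(y k) -/(y l).
  move: (f k).1.1 (f k).1.2 (f k).2 => A B' C e4 k1 k2 d1 n1.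
  have AR : A%:~R != 0 :> R by rewrite intr_eq0.
  have sq t : kills A B' C t -> ((2 * A)%:~R * t + B'%:~R) ^+ 2 = Dl%:~R :> R.
    move=> kt; rewrite -d1 rmorphB/= rmorphXn/= !rmorphM/=.
    transitivity (4 * A%:~R * (A%:~R * t ^+ 2 + B'%:~R * t + C%:~R) +
       (B'%:~R ^+ 2 - 4 * A%:~R * C%:~R) : R); first by ring.
    by rewrite kt mulr0 add0r.
  have : (2 * A)%:~R * y k + B'%:~R = (2 * A)%:~R * y l + B'%:~R :> R.
    have := sq _ k1; rewrite -(sq _ k2) => /eqP; rewrite eqf_sqr => /orP[/eqP//|/eqP h].
    move: e4; rewrite h oppr_ge0 => e4.
    have [h1|h1] := leP ((2 * A)%:~R * y l + B'%:~R) 0.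
      move: e4; rewrite h1 => /esym h2.
      have -> : (2 * A)%:~R * y l + B'%:~R = 0 by apply/eqP; rewrite eq_le h1 h2.
      by rewrite oppr0.
    by move: e4; rewrite leNgt h1 /= => /esym; rewrite (ltW h1).
  move=> /addIr /mulfI; apply.
  by rewrite intr_eq0 mulf_neq0.
have eij := eqy i j gij.
have [h|h|h] := ltngtP (nat_of_ord i) (nat_of_ord j).
- exists (nat_of_ord i); exists (nat_of_ord j); by split.
- exists (nat_of_ord j); exists (nat_of_ord i); by split.
- by case/eqP: ij; apply: val_inj.
Qed.

Lemma cf_period_exists (R : realType) (x : R) (Dl : int) : irrational x -> disc_form Dl x ->
  exists b, cf_period x b.
Proof.
move=> xirr dx; have [i [j [ij hij]]] := lagrange_repeat R x Dl xirr dx.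
pose L := (j - i)%N; have L0 : (0 < L)%N by rewrite subn_gt0.
pose b := mkseq (fun k => absz (partial_quotient x (i.+1 + k))) L.
have szb : size b = L by rewrite size_mkseq.
exists b; split; first by rewrite szb.
exists i.+1 => k; rewrite szb.
have per m : complete_quotient x (i.+1 + (m + L)) = complete_quotient x (i.+1 + m).
  rewrite (_ : i.+1 + (m + L) = j.+1 + m)%N; last by rewrite /L; lia.
  by rewrite !complete_quotientD hij.
have perq m n : complete_quotient x (i.+1 + (m + n * L)) = complete_quotient x (i.+1 + m).
  elim: n => [|n IH]; first by rewrite mul0n addn0.
  by rewrite mulSn (_ : m + (L + n * L) = m + n * L + L)%N ?per//; lia.
rewrite nth_mkseq ?ltn_pmod// /partial_quotient.
rewrite {1}(divn_eq k L) [(k %/ L * L + _)%N]addnC perq.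
rewrite gez0_abs// -/(partial_quotient x (i.+1 + k %% L)).
by have := partial_quotient_ge1 R x (i + k %% L) xirr; rewrite addSn; lia.
Qed.

Lemma exists_min (P : nat -> Prop) : (exists n, P n) ->
  exists n, P n /\ forall m, P m -> (n <= m)%N.
Proof.
move=> [n Pn].
have ex : exists n, `[< P n >] by exists n; apply/asboolP.
case: (ex_minnP ex) => m /asboolP Pm hm; exists m; split => // k Pk.
by apply: hm; apply/asboolP.
Qed.

Lemma cf_shortest_period_period (R : realType) (x : R) (Dl : int) : irrational x ->
  disc_form Dl x -> cf_shortest_period x (period x).
Proof.
move=> xirr dx; have [b hb] := cf_period_exists R x Dl xirr dx.
have [n [[b' [hb' sb']] hn]] := exists_min (fun n => exists b, cf_period x b /\ size b = n)
  (ex_intro _ (size b) (ex_intro _ b (conj hb erefl))).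
rewrite /period; case: xgetP => [y -> //|/(_ b') []]; split => // b2 hb2.
by rewrite sb'; apply: hn; exists b2.
Qed.

(** The first digit of [x] may be negative, but each entry of a period recurs at a
later position. *)
Lemma cf_period_digits (R : realType) (x : R) (b : seq nat) : irrational x -> cf_period x b ->
  forall i, (i < size b)%N -> (1 <= nth 0%N b i)%N.
Proof.
move=> xirr [sb [N hN]] i ib.
have := hN (i + size b)%N; rewrite modnDr modn_small// => h.
have := partial_quotient_ge1 R x (N + i + (size b).-1) xirr.
rewrite (_ : (N + i + (size b).-1).+1 = N + (i + size b))%N ?h; lia.
Qed.

Lemma disc_form_step (R : realType) (Dl : int) (x : R) k : irrational x ->
  disc_form Dl (complete_quotient x k.+1) -> disc_form Dl (complete_quotient x k).
Proof.
move=> xirr dy; have yirr := irrational_complete_quotient R x k.+1 xirr.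
have Dl0 := disc_gt0 R Dl _ yirr dy.
have [y0 E] := complete_quotient_eq R x k xirr.
have zirr := irrational_complete_quotient R x k xirr.
case: dy => A [B [C [A0 DE ky]]].
move: (complete_quotient x k.+1) (complete_quotient x k) (partial_quotient x k)
  ky E y0 zirr {yirr} => y z a ky E y0 zirr.
have yN : y != 0 by rewrite gt_eqF.
exists C, (B - 2 * a * C), (A - B * a + C * a ^+ 2).
have DE' : (B - 2 * a * C) ^+ 2 - 4 * C * (A - B * a + C * a ^+ 2) = Dl.
  by rewrite -DE; ring.
have kz : kills C (B - 2 * a * C) (A - B * a + C * a ^+ 2) z.
  rewrite /kills E !(rmorphD, rmorphB, rmorphM, rmorphXn)/=.
  transitivity ((A%:~R * y ^+ 2 + B%:~R * y + C%:~R) / y ^+ 2 : R); last by rewrite ky mul0r.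
  by field.
by split => //; apply: kills_lead zirr kz _; rewrite DE' gt_eqF.
Qed.

(** The complete quotient where the period starts is fixed by the matrix
(p, p'; q, q') of the period, so it is killed by (q, q' - p, - p'); the
discriminant is kept on the way back to [x]. *)
Lemma disc_form_of_period (R : realType) (x : R) (b : seq nat) : irrational x -> cf_period x b ->
  exists Dl : int, disc_form Dl x /\ Dl <= 5 * (psi_B b)%:Z ^+ (2 * size b).
Proof.
move=> xirr hb; have dig := cf_period_digits R x b xirr hb.
case: hb => sb [N hN].
have yirr := irrational_complete_quotient R x N xirr.
set y := complete_quotient x N in yirr.
have pyE k : partial_quotient y k = (nth 0%N b (k %% size b))%:Z.
  by rewrite -partial_quotientD hN.
case sE: (size b) sb dig pyE => [//|s] _ dig pyE.
have [p [q [p' [q' [[dt q'0 q'q q1 _] hx hB]]]]] := convergents R y s yirr.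
have yper : complete_quotient y s.+1 = y.
  apply: digits_inj => //; first exact: irrational_complete_quotient.
  by move=> k; rewrite -partial_quotientD !pyE modnDl.
have := hx y yirr (fun j _ => erefl); cbv zeta; rewrite yper => E.
have [|p0 p'0 pB qB] := hB (psi_B b)%:Z.
  move=> j js; rewrite pyE modn_small//; split; first by rewrite lez_nat; apply: dig.
  rewrite /psi_B; have : (nth 0%N b j <= \max_(i <- b) i)%N.
    by apply: (@leq_bigmax_seq _ b xpredT id) => //; apply: mem_nth; by rewrite sE ltnS.
  lia.
exists ((q' - p) ^+ 2 + 4 * q * p'); split; last first.
  have BE : (psi_B b)%:Z ^+ (2 * s.+1) = ((psi_B b)%:Z ^+ s.+1) ^+ 2 by rewrite mulnC exprM.
  by rewrite BE; move: pB qB; move: (_ ^+ s.+1) => X pB qB; nia.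
have dy : disc_form ((q' - p) ^+ 2 + 4 * q * p') y.
  exists q, (q' - p), (- p'); split; first by lia.
    by ring.
  rewrite /kills rmorphB rmorphN/=.
  transitivity (y * (q%:~R * y + q'%:~R) - (p%:~R * y + p'%:~R) : R); first by ring.
  by rewrite E subrr.
move: dy; rewrite /y; elim: (N) => [//|n IH] dy.
by apply: IH; apply: disc_form_step.
Qed.

(** * The bound and the spectrum *)

(** The exponent exists because powers of 2 are unbounded; otherwise [psi_n] would
have its default value 0. *)
Lemma psi_n_gt0 (b : seq nat) : (0 < size b)%N -> (0 < psi_n b)%N.
Proof.
move=> sb; pose K := (16 * 16 * 36 * 144 * psi_B b ^ (2 * size b + 8))%N.
have [|n [hn hm]] := exists_min (psi_n_cond b).
  exists K.+1; split => //; rewrite subSS subn0 -/K.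
  apply: leq_trans (ltn_expl K (isT : 1 < 2)%N) _.
  by rewrite leq_exp2l// leq_pmulr.
rewrite /psi_n; case: xgetP => [m _ [[]]//|/(_ n)[]].
by split.
Qed.

(** The square of the discriminant is at most 25 B^(4s), and the denominator of
psi has at least the additional factor B^12 >= 3^12. *)
Lemma psi_bound (R : realType) (x : R) (Dl : int) : irrational x -> disc_form Dl x ->
  exists2 Dl' : int, disc_form Dl' x &
   2 * (10 ^+ 6 * (Dl'%:~R ^+ 2 * psi x)) <= 1 :> R.
Proof.
move=> xirr dx; have [per _] := cf_shortest_period_period R x Dl xirr dx.
have [Dl' [dx' DB]] := disc_form_of_period R x _ xirr per.
exists Dl' => //; have Dl'0 := disc_gt0 R Dl' x xirr dx'.
have dig := cf_period_digits R x _ xirr per.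
have sb : (0 < size (period x))%N := per.1.
have n0 := psi_n_gt0 _ sb.
rewrite /psi; move: (period x) (psi_n (period x)) DB dig sb n0 => b n DB dig sb n0.
have B3 : (3 <= psi_B b)%N.
  rewrite /psi_B -[3%N]/(2 + 1)%N leq_add2l; apply: leq_trans (dig 0%N sb) _.
  by apply: (@leq_bigmax_seq _ b xpredT id) => //; apply: mem_nth.
move: (psi_B b) B3 DB => B B3 DB.
have B0 : 0 < B%:R :> R by rewrite ltr0n; lia.
have B1 : 1 <= B%:R :> R by rewrite ler1n; lia.
pose X : R := B%:R ^+ (4 * size b).
have X0 : 0 < X by rewrite exprn_gt0.
have DX : Dl'%:~R ^+ 2 <= 25 * X :> R.
  have h : Dl'%:~R <= 5 * B%:R ^+ (2 * size b) :> R.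
    by move: DB; rewrite -(ler_int R) intrM rmorphXn/=.
  have -> : 25 * X = (5 * B%:R ^+ (2 * size b)) ^+ 2.
    rewrite exprMn -exprM /X (_ : 2 * size b * 2 = 4 * size b)%N; last by lia.
    by congr (_ * _); ring.
  by rewrite ler_sqr ?nnegrE ?ler0z ?mulr_ge0 ?exprn_ge0//; lia.
have big : 10 ^+ 4 * X <= B%:R ^+ (size b * (6 * n + 6) + 4).
  have -> : (size b * (6 * n + 6) + 4 =
    4 * size b + (12 + (6 * (n * size b) + 2 * size b - 8)))%N by nia.
  rewrite (exprD _ (4 * size b)) (exprD _ 12) -/X [leRHS]mulrC.
  have h1 : 10 ^+ 4 <= B%:R ^+ 12 :> R.
    have h3 : (3 ^ 12 <= B ^ 12)%N by rewrite leq_exp2r.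
    have : 3 ^+ 12 <= B%:R ^+ 12 :> R by rewrite -!natrX ler_nat.
    by apply: le_trans; lra.
  have h2 : 1 <= B%:R ^+ (6 * (n * size b) + 2 * size b - 8) :> R by apply: exprn_ege1.
  have h4 : 10 ^+ 4 * 1 <= B%:R ^+ 12 * B%:R ^+ (6 * (n * size b) + 2 * size b - 8) :> R.
    by apply: ler_pM => //; apply: exprn_ge0.
  by rewrite mulr1 in h4; apply: ler_wpM2r => //; exact: ltW.
move: big; move: (B%:R ^+ (size b * (6 * n + 6) + 4)) => Y big.
have Y0 : 0 < Y by move: big X0; clear; lra.
rewrite div1r (_ : 2 * _ = 2 * 10 ^+ 6 * Dl'%:~R ^+ 2 / (72 * 72 * Y)); last by ring.
rewrite ler_pdivrMr ?mul1r; last by move: Y0; clear; lra.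
by move: DX big Y0; move: (Dl'%:~R ^+ 2 : R); clear; move=> D D1 D2 D3; lra.
Qed.

Lemma psi_gt0 (R : realType) (x : R) : 0 < psi x.
Proof. by rewrite /psi divr_gt0// !mulr_gt0// exprn_gt0// ltr0n /psi_B. Qed.

Lemma approx_constE (R : realType) (alpha xi c : R) :
  (forall b, Theta alpha b -> c <= approx (@galois_conj R) xi b) ->
  (forall e : R, 0 < e -> exists2 b, Theta alpha b &
     `|b - galois_conj b| < e /\ approx (@galois_conj R) xi b < c + e) ->
  approx_const alpha xi = c%:E.
Proof.
move=> lo hi; rewrite /approx_const limf_einfE; apply/eqP; rewrite eq_le; apply/andP; split.
  apply: ge_ereal_sup => _ [V [e e0 hV] <-].
  apply/lee_addgt0Pr => d d0.
  have [|b Tb [b1 b2]] := hi (Num.min d e); first by rewrite lt_min d0.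
  apply: (@le_trans _ _ (approx (@galois_conj R) xi b)%:E).
    apply: ereal_inf_lbound; exists b => //; apply: hV; split => //.
    by apply: lt_le_trans b1 _; rewrite ge_min lexx orbT.
  rewrite -EFinD lee_fin; apply: le_trans (ltW b2) _.
  by rewrite lerD2l ge_min lexx.
apply: (@le_trans _ _ (ereal_inf ((fun b : R => (2 * (`|xi - b| / `|b - galois_conj b|))%:E) @`
   [set b | Theta alpha b /\ `|b - galois_conj b| < 1]))).
  by apply: le_ereal_inf_tmp => _ [b [Tb _] <-]; rewrite lee_fin; apply: lo.
apply: ereal_sup_ubound; exists [set b | Theta alpha b /\ `|b - galois_conj b| < 1] => //.
by exists 1 => //; exact: ltr01.
Qed.

Theorem theorem1p1 (R : realType) (alpha : R) (halpha : real_quadratic alpha) :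
  0 < psi alpha /\
  EFin @` `[0, psi alpha] `<=` quadratic_spectrum alpha.
Proof.
split; first exact: psi_gt0.
move=> _ [c + <-]; rewrite /= in_itv/= => /andP[c0 cpsi].
have airr := halpha.1.
have [Dl0 da0] := disc_form_real_quadratic R alpha halpha.
have [Dl da hpsi] := psi_bound R alpha Dl0 airr da0.
have fam := Theta_family R Dl alpha airr da.
have Ta : Theta alpha !=set0.
  exists (mob 1 0 0 1 alpha); left; exact: mem_PSL2Z_orbit.
have [|xi [xiQ xiT lo hi]] := family_spectrum _ _ _ _ fam c Ta c0.
  apply: le_trans hpsi; rewrite ler_pM2l// ler_pM2l ?exprn_gt0//.
  by apply: ler_wpM2l => //; exact: sqr_ge0.
exists xi; last exact: approx_constE.
by move=> [|].
Qed.
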